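(* There exists an absolute constant $c>0$ such that the following holds. Let $G$ be a finite Abelian group (written additively) with $|G|\ge 3$, and let $A\subseteq G\times G$ be a set of cardinality at least $|G|^2/(\log\log|G|)^c$. Then $A$ contains a corner, i.e. there are $k,m,d\in G$ with $d\neq 0$ such that $(k,m),\ (k+d,m),\ (k,m+d)\in A$.
   Context: A corner in $G\times G$ is a triple $\{(k,m),(k+d,m),(k,m+d)\}$ with $k,m,d\in G$ and $d\ne 0$. Here $\log$ is the natural logarithm. *)

(* Defs.v *)
From HB Require Import structures.
From mathcomp Require Import all_boot all_order all_algebra.
From mathcomp Require Import all_reals exp.
Set Implicit Arguments.
Unset Strict Implicit.
Unset Printing Implicit Defensive.

(* Main.v *)
(** The proof is a density increment on products of pseudorandom sets, following
    Shkredov.  Inside a product of two Bohr sets [B x C], the second much narrower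
    than the first, let [A] have relative density [de] in [E1 x E2].  If [E1] and
    [E2] are locally uniform, two applications of Cauchy-Schwarz show that a set [A]
    without corners correlates with a smaller product [F1 x F2], on which its
    density exceeds [de] by a fixed power of [de].  If [E1] or [E2] is not uniform, a
    large Fourier coefficient gives a narrower Bohr set along whose translates the
    density of [E1] or [E2] has a large variance.  Uniformity is recovered by
    following a single branch: the excess of [A] over [th E1 x E2] plus a small
    multiple of the squared densities of [E1] and [E2] increases, on average over the
    translates, whenever uniformity fails, hence on some translate, and it is
    bounded.  All losses are exponential in a power of [1/de], for the densities of
    [E1] and [E2] as well as for the ranks and log-radii of the Bohr sets, which
    leaves a doubly exponential condition on [|G|]. *)
Require Import Defs.
From HB Require Import structures.
From mathcomp Require Import all_boot all_order all_algebra.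
From mathcomp Require Import all_fingroup all_field all_character.
From mathcomp Require Import boolp all_reals sequences exp.
From mathcomp Require Import ring lra zify.
Set Implicit Arguments.
Unset Strict Implicit.
Unset Printing Implicit Defensive.
Import Order.TTheory GRing.Theory Num.Theory.
Local Open Scope ring_scope.

(** * Averages over finite sets *)

(** Bohr sets are not groups, so [x], [y] and [x + y] cannot range over one set. Here [x] and
    [x + y] share the wide set [B] and [y] has the narrow set [C], which makes passing from one to
    the other cost only [e]. For the same reason the uniformity of [E1] is tested on the translates
    [z + C], on average over [z] in [B], and that of [E2] on [C], both by shifts from a third, still
    narrower set [D]. The densities [b1], [b2] of [E1], [E2] may become far smaller than [de], and
    the increment must not depend on them. Hence the Cauchy-Schwarz steps keep the indicators of
    [E1] and [E2] as weights. Uniformity replaces the weights by their means, and then the lower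
    bound for the box norm of the balanced function and the upper bound that holds without an
    increment carry the same factor [(b1 * b2) ^ 2]. The increment is a multiple of [de ^ 10]; only
    the admissible errors involve the densities. Characters take values in [algC], so the functions
    tested against them are rational, embedded by [ratr]; the counting and increment arguments are
    stated over any ordered field and applied over [rat]. Real numbers enter with the logarithms at
    the end. *)

Section Average.
Variables (K : numFieldType) (T : finType).
Implicit Types (B : {set T}) (f g : T -> K) (a e : K).

Definition avg B f : K := (\sum_(x in B) f x) / #|B|%:R.

Lemma eq_avg B f g : (forall x, x \in B -> f x = g x) -> avg B f = avg B g.
Proof. by move=> fg; rewrite /avg (eq_bigr _ fg). Qed.

Lemma avgD B f g : avg B (fun x => f x + g x) = avg B f + avg B g.
Proof. by rewrite /avg big_split mulrDl. Qed.

Lemma avgN B f : avg B (fun x => - f x) = - avg B f.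
Proof. by rewrite /avg sumrN mulNr. Qed.

Lemma avgB B f g : avg B (fun x => f x - g x) = avg B f - avg B g.
Proof. by rewrite avgD avgN. Qed.

Lemma avgZ B a f : avg B (fun x => a * f x) = a * avg B f.
Proof. by rewrite /avg -mulr_sumr mulrA. Qed.

Lemma avgZr B a f : avg B (fun x => f x * a) = avg B f * a.
Proof. by rewrite /avg -mulr_suml mulrAC. Qed.

Lemma avg_cst B a : (0 < #|B|)%N -> avg B (fun=> a) = a.
Proof.
move=> B0; rewrite /avg sumr_const -(mulr_natr a) mulfK //.
by rewrite pnatr_eq0 -lt0n.
Qed.

Lemma ler_avg B f g : (forall x, x \in B -> f x <= g x) -> avg B f <= avg B g.
Proof. by move=> fg; rewrite ler_wpM2r ?invr_ge0 ?ler0n ?ler_sum. Qed.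

Lemma avg_ge0 B f : (forall x, x \in B -> 0 <= f x) -> 0 <= avg B f.
Proof. by move=> f0; rewrite divr_ge0 ?ler0n ?sumr_ge0. Qed.

Lemma norm_avg B f : `|avg B f| <= avg B (fun x => `|f x|).
Proof.
rewrite normrM normfV [`|#|B|%:R|]ger0_norm ?ler0n //.
by rewrite ler_wpM2r ?invr_ge0 ?ler0n ?ler_norm_sum.
Qed.

Lemma avg_le B f e :
  (0 < #|B|)%N -> (forall x, x \in B -> f x <= e) -> avg B f <= e.
Proof. by move=> B0 h; rewrite -[leRHS](avg_cst e B0) ler_avg. Qed.

Lemma norm_avg_le B f e :
  (0 < #|B|)%N -> (forall x, x \in B -> `|f x| <= e) -> `|avg B f| <= e.
Proof. by move=> B0 h; apply: le_trans (norm_avg _ _) (avg_le B0 h). Qed.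

Lemma avg_close B f g e : (0 < #|B|)%N ->
  (forall x, x \in B -> `|f x - g x| <= e) -> `|avg B f - avg B g| <= e.
Proof. by move=> B0 h; rewrite -avgB norm_avg_le. Qed.

End Average.

Lemma exchange_avg (K : numFieldType) (S T : finType) (A : {set S}) (B : {set T})
    (f : S -> T -> K) :
  avg A (fun x => avg B (f x)) = avg B (fun y => avg A (f^~ y)).
Proof.
by rewrite /avg -!mulr_suml exchange_big -!mulrA [_^-1 * _]mulrC.
Qed.

Lemma avg_setX (K : numFieldType) (S T : finType) (A : {set S}) (B : {set T})
    (f : S -> T -> K) :
  avg (setX A B) (fun p => f p.1 p.2) = avg A (fun x => avg B (f x)).
Proof.
rewrite /avg -mulr_suml cardsX natrM invfM mulrA mulrAC; congr (_ / _ / _).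
by rewrite pair_big_dep /=; apply: eq_bigl => -[x y]; rewrite in_setX.
Qed.

Section RealAverage.
Variables (R : realFieldType).

Lemma avg_exists (T : finType) (B : {set T}) (f : T -> R) :
  (0 < #|B|)%N -> exists2 x, x \in B & avg B f <= f x.
Proof.
move=> B0; apply/exists_inP; apply: contraT.
rewrite negb_exists_in => /forall_inP h.
have: \sum_(x in B) f x < \sum_(x in B) avg B f.
  apply: ltr_sum => [|x xB]; last by rewrite ltNge h.
  by case/card_gt0P: B0 => x xB; apply/hasP; exists x => //; rewrite mem_index_enum.
rewrite sumr_const -(mulr_natr (avg B f)) divfK ?ltxx //.
by rewrite pnatr_eq0 -lt0n.
Qed.

(** Lagrange's identity: the defect is half the double sum of [(f x * g y - f y * g x) ^ 2]. *)
Lemma cauchy_schwarz_sum (T : finType) (B : {set T}) (f g : T -> R) :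
  (\sum_(x in B) f x * g x) ^+ 2
    <= (\sum_(x in B) f x ^+ 2) * (\sum_(x in B) g x ^+ 2).
Proof.
have h : 0 <= \sum_(x in B) \sum_(y in B) (f x * g y - f y * g x) ^+ 2.
  by do 2!apply: sumr_ge0 => ? _; apply: sqr_ge0.
suff e : \sum_(x in B) \sum_(y in B) (f x * g y - f y * g x) ^+ 2
  = 2 * ((\sum_(x in B) f x ^+ 2) * (\sum_(x in B) g x ^+ 2)
         - (\sum_(x in B) f x * g x) ^+ 2).
  by move: h; rewrite e pmulr_rge0 // subr_ge0.
transitivity (\sum_(x in B) (f x ^+ 2 * (\sum_(y in B) g y ^+ 2)
    + (\sum_(y in B) f y ^+ 2) * g x ^+ 2
    - 2 * (f x * g x) * (\sum_(y in B) f y * g y))).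
  apply: eq_bigr => x _; rewrite mulr_sumr mulr_suml mulr_sumr -sumrN -!big_split.
  by apply: eq_bigr => y _ /=; ring.
rewrite !big_split /= sumrN -!mulr_suml -!mulr_sumr; ring.
Qed.

Lemma avg_cs (T : finType) (B : {set T}) (f g : T -> R) :
  avg B (fun x => f x * g x) ^+ 2
    <= avg B (fun x => f x ^+ 2) * avg B (fun x => g x ^+ 2).
Proof.
rewrite /avg exprMn [leRHS]mulrACA -(expr2 _^-1).
by rewrite ler_wpM2r ?cauchy_schwarz_sum ?sqr_ge0.
Qed.

Lemma avg_jensen (T : finType) (B : {set T}) (f : T -> R) :
  avg B f ^+ 2 <= avg B (fun x => f x ^+ 2).
Proof.
have [B0|] := posnP #|B|.
  by rewrite /avg (cards0_eq B0) !big_set0 !mul0r expr0n.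
move=> B0; have := avg_cs B f (fun=> 1).
under eq_avg do rewrite mulr1.
by rewrite expr1n avg_cst // mulr1.
Qed.

Lemma avg_jensen4 (T : finType) (B : {set T}) (f : T -> R) :
  avg B f ^+ 4 <= avg B (fun x => f x ^+ 4).
Proof.
have -> : avg B f ^+ 4 = (avg B f ^+ 2) ^+ 2 by rewrite -exprM.
have h : (avg B f ^+ 2) ^+ 2 <= avg B (fun x => f x ^+ 2) ^+ 2.
  apply: lerXn2r (avg_jensen B f); rewrite nnegrE ?sqr_ge0 //.
  by apply: avg_ge0 => x _; apply: sqr_ge0.
apply: le_trans h (le_trans (avg_jensen _ _) _).
by apply: ler_avg => x _; rewrite -exprM.
Qed.

Lemma avg2_cs (S T : finType) (A : {set S}) (B : {set T}) (f g : S -> T -> R) :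
  avg A (fun x => avg B (fun y => f x y * g x y)) ^+ 2
    <= avg A (fun x => avg B (fun y => f x y ^+ 2))
       * avg A (fun x => avg B (fun y => g x y ^+ 2)).
Proof.
rewrite -!avg_setX.
exact: (avg_cs (setX A B) (fun p => f p.1 p.2) (fun p => g p.1 p.2)).
Qed.

Lemma avg3_cs (S T U : finType) (A : {set S}) (B : {set T}) (C : {set U})
    (f g : S -> T -> U -> R) :
  avg A (fun x => avg B (fun y => avg C (fun z => f x y z * g x y z))) ^+ 2
    <= avg A (fun x => avg B (fun y => avg C (fun z => f x y z ^+ 2)))
       * avg A (fun x => avg B (fun y => avg C (fun z => g x y z ^+ 2))).
Proof.
do 3!rewrite -(avg_setX A B (fun x y => avg C _)).
exact: (avg2_cs (setX A B) C (fun p => f p.1 p.2) (fun p => g p.1 p.2)).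
Qed.

End RealAverage.

(** * Approximate invariance and local uniformity *)

Section Shift.
Variable G : finZmodType.
Implicit Types (B D : {set G}) (t : G).

Definition leavers B t : {set G} := [set x in B | x + t \notin B].

(** Terms common to both sums cancel. Two boundary sets remain, of equal size because their
    complements in [B] are translates of each other. *)
Lemma norm_shift_sum (K : numFieldType) B t (f : G -> K) :
  (forall x, `|f x| <= 1) ->
  `|\sum_(x in B) f (x + t) - \sum_(x in B) f x| <= (2 * #|leavers B t|)%:R.
Proof.
move=> f1; set L := leavers B t.
rewrite (bigID (fun x => x + t \in B)) /=.
rewrite [X in _ - X](bigID (fun x => x - t \in B)) /=.
have -> : \sum_(i in B | i + t \in B) f (i + t) = \sum_(i in B | i - t \in B) f i.
  rewrite (reindex_inj (addIr (- t))) /=; apply: eq_big => x.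
    by rewrite subrK andbC.
  by move=> _; rewrite subrK.
have cardL : #|[set x in B | x - t \notin B]| = #|L|.
  have eq1 (p : pred G) : #|[set x in B | ~~ p x]| = (#|B| - #|[set x in B | p x]|)%N.
    rewrite -[X in (X - _)%N](cardsID [set x | p x]) -setIdE addKn.
    by apply: eq_card => x; rewrite !inE andbC.
  rewrite eq1 [RHS](eq1 (fun x => x + t \in B)); congr (_ - _)%N.
  rewrite -(card_imset (mem [set x in B | x + t \in B]) (addIr t)).
  apply: eq_card => x; apply/idP/imsetP => [|[y]].
    rewrite inE => /andP[xB xtB]; exists (x - t); last by rewrite subrK.
    by rewrite inE subrK xB xtB.
  by rewrite !inE => /andP[yB ytB] ->; rewrite addrK yB ytB.
rewrite opprD addrACA subrr add0r.
apply: le_trans (ler_normB _ _) _; rewrite mul2n -addnn natrD.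
apply: lerD; apply: le_trans (ler_norm_sum _ _ _) _.
  apply: le_trans (ler_sum _ (fun i _ => f1 (i + t))) _.
  by rewrite sumr_const [in leRHS]cardsE.
apply: le_trans (ler_sum _ (fun i _ => f1 i)) _.
by rewrite sumr_const -cardL cardsE.
Qed.

(* The translates [B + t], for [t] in [T], differ little from [B]; the factor 2
   makes [e] the error when an average of a 1-bounded function is translated. *)
Definition ainv (R : numFieldType) (B T : {set G}) (e : R) : Prop :=
  forall t, t \in T -> (2 * #|leavers B t|)%:R <= e * #|B|%:R.

Lemma ainv_avg (R : numFieldType) (B T : {set G}) (e : R) (f : G -> R) t :
  (0 < #|B|)%N -> ainv B T e -> t \in T -> (forall x, `|f x| <= 1) ->
  `|avg B (fun x => f (x + t)) - avg B f| <= e.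
Proof.
move=> B0 BT tT f1; rewrite /avg -mulrBl normrM normfV.
rewrite [`|#|B|%:R|]ger0_norm ?ler0n // ler_pdivrMr ?ltr0n //.
apply: le_trans (norm_shift_sum B t f1) _. exact: BT.
Qed.

Lemma ainvS (R : numFieldType) (B T T' : {set G}) (e : R) :
  T' \subset T -> ainv B T e -> ainv B T' e.
Proof. by move=> /subsetP TT' BT t /TT'; apply: BT. Qed.

Lemma avg_opp (K : numFieldType) B (f : G -> K) :
  (forall x, x \in B -> - x \in B) -> avg B (fun x => f (- x)) = avg B f.
Proof.
move=> BN; rewrite /avg [in RHS](reindex_inj (@oppr_inj G)).
congr (_ / _); apply: eq_bigl => x.
by apply/idP/idP=> /BN //; rewrite opprK.
Qed.

End Shift.

Section Uniformity.
Variables (R : realFieldType) (G : finZmodType).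
Implicit Types (B D : {set G}) (f u v : G -> R).

(* The fourth power of the U^2 norm, localized to [B] at the smaller scale [D]. *)
Definition unorm B D f : R :=
  avg D (fun w => avg D (fun w' => avg B (fun y => f (y + w) * f (y + w')) ^+ 2)).

(** Cauchy-Schwarz in [y] removes [u] and doubles [w]; a second one in [(w, w')] removes [v] and
    leaves the squared correlations of [unorm]. *)
Lemma unorm_bilinear B D f u v : (0 < #|B|)%N ->  (0 < #|D|)%N ->
  (forall x, `|u x| <= 1) -> (forall x, `|v x| <= 1) ->
  avg B (fun y => avg D (fun w => f (y + w) * u y * v w)) ^+ 4 <= unorm B D f.
Proof.
move=> B0 D0 u1 v1.
have sq1 (z : R) : `|z| <= 1 -> z ^+ 2 <= 1.
  by rewrite -real_normK ?num_real // => h; rewrite expr_le1.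
set X := avg B _.
have -> : X ^+ 4 = (X ^+ 2) ^+ 2 by rewrite -exprM.
have hX : X = avg B (fun y => avg D (fun w => f (y + w) * v w) * u y).
  apply: eq_avg => y _; rewrite -avgZr; apply: eq_avg => w _; ring.
pose Y := avg D (fun w => avg D (fun w' =>
  (v w * v w') * avg B (fun y => f (y + w) * f (y + w')))).
have XY : X ^+ 2 <= Y.
  rewrite hX; apply: le_trans (avg_cs _ _ _) _.
  have -> : Y = avg B (fun y => avg D (fun w => f (y + w) * v w) ^+ 2).
    transitivity (avg B (fun y => avg D (fun w => avg D (fun w' =>
      (f (y + w) * v w) * (f (y + w') * v w'))))); last first.
      apply: eq_avg => y _; rewrite expr2 -avgZ.
      rewrite exchange_avg; apply: eq_avg => w _; rewrite avgZr; ring.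
    rewrite exchange_avg; apply: eq_avg => w _.
    rewrite exchange_avg; apply: eq_avg => w' _.
    by rewrite -avgZ; apply: eq_avg => y _; ring.
  rewrite -[leRHS]mulr1 ler_wpM2l ?avg_ge0 // => [x _|]; first exact: sqr_ge0.
  by apply: avg_le => // x _; apply: sq1.
apply: (@le_trans _ _ (Y ^+ 2)).
  by apply: lerXn2r (XY); rewrite nnegrE ?sqr_ge0 // (le_trans _ XY) ?sqr_ge0.
apply: le_trans (avg2_cs _ _ _ _) _.
rewrite -[leRHS]mul1r ler_wpM2r //.
  by do 2!(apply: avg_ge0 => ? _); apply: sqr_ge0.
do 2!(apply: avg_le => // ? _).
by rewrite sq1 // normrM mulr_ile1.
Qed.

End Uniformity.

Notation "'\avg_' ( x 'in' B ) F" := (avg B (fun x => F))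
  (at level 41, x name, F at level 41, B at level 50,
   format "'[' '\avg_' ( x  'in'  B ) '/  '  F ']'") : ring_scope.

Section Shift3.
Variables (R : realFieldType) (G : finZmodType) (B C D : {set G}) (e : R).
Hypotheses (B0 : (0 < #|B|)%N) (C0 : (0 < #|C|)%N) (D0 : (0 < #|D|)%N).
Hypotheses (BD : ainv B D e) (CD : ainv C D e).

Lemma avg3_shift (f : G -> G -> G -> R) : (forall x y z, `|f x y z| <= 1) ->
  `|\avg_(w in D) \avg_(x in B) \avg_(y in C) \avg_(z in C) f (x + w) (y + w) (z + w)
    - \avg_(x in B) \avg_(y in C) \avg_(z in C) f x y z| <= 3 * e.
Proof.
move=> f1.
rewrite -[X in `|_ - X|](avg_cst _ D0); apply: avg_close => // w wD.
have -> : 3 * e = e + (e + e) by ring.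
have h1 : `|\avg_(x in B) \avg_(y in C) \avg_(z in C) f (x + w) (y + w) (z + w)
  - \avg_(x in B) \avg_(y in C) \avg_(z in C) f x (y + w) (z + w)| <= e.
  apply: (ainv_avg (f := fun x => \avg_(y in C) \avg_(z in C) f x (y + w) (z + w)) B0 BD wD).
  by move=> x /=; do 2!(apply: norm_avg_le => // ? _).
have h2 : `|\avg_(x in B) \avg_(y in C) \avg_(z in C) f x (y + w) (z + w)
  - \avg_(x in B) \avg_(y in C) \avg_(z in C) f x y (z + w)| <= e.
  apply: avg_close => // x _.
  apply: (ainv_avg (f := fun y => \avg_(z in C) f x y (z + w)) C0 CD wD).
  by move=> y /=; apply: norm_avg_le.
have h3 : `|\avg_(x in B) \avg_(y in C) \avg_(z in C) f x y (z + w)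
  - \avg_(x in B) \avg_(y in C) \avg_(z in C) f x y z| <= e.
  do 2!(apply: avg_close => // ? _).
  exact: (ainv_avg C0 CD wD).
apply: le_trans (ler_distD _ _ _) (lerD h1 _).
exact: le_trans (ler_distD _ _ _) (lerD h2 h3).
Qed.

End Shift3.

Lemma exchange_avg3 (R : realFieldType) (S T : finType) (A : {set S}) (B C D : {set T})
    (f : S -> T -> T -> T -> R) :
  \avg_(w in A) \avg_(x in B) \avg_(y in C) \avg_(z in D) f w x y z
  = \avg_(x in B) \avg_(y in C) \avg_(z in D) \avg_(w in A) f w x y z.
Proof.
rewrite exchange_avg; apply: eq_avg => x _.
by rewrite exchange_avg; apply: eq_avg => y _; rewrite exchange_avg.
Qed.

Section Negligible.
Variables (R : realFieldType) (G : finZmodType) (B C D : {set G}) (e eta : R).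
Hypotheses (B0 : (0 < #|B|)%N) (C0 : (0 < #|C|)%N) (D0 : (0 < #|D|)%N).
Hypotheses (BD : ainv B D e) (CD : ainv C D e).
Hypothesis CN : forall x, x \in C -> - x \in C.
Variable f : G -> R.
Hypotheses (f1 : forall x, `|f x| <= 1) (eta0 : 0 <= eta).

Lemma norm_le_pow4 (x y : R) : 0 <= y -> x ^+ 4 <= y ^+ 4 -> `|x| <= y.
Proof.
move=> y0; have -> : x ^+ 4 = `|x| ^+ 4.
  by rewrite -[RHS]normrX ger0_norm // -[4%N]/(2 * 2)%N exprM sqr_ge0.
by rewrite ler_pXn2r ?nnegrE.
Qed.

(* Translating [z], [y] and [y'] by the same [w] fixes the arguments of [u], so
   [f] is tested against a function of the inner variable times one of [w]. *)
Lemma avg_uniform_negligible (u v : G -> G -> G -> R) :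
  \avg_(z in B) unorm C D (fun x => f (z + x)) <= eta ^+ 4 ->
  (forall x y z, `|u x y z| <= 1) -> (forall x y z, `|v x y z| <= 1) ->
  `|\avg_(z in B) \avg_(y in C) \avg_(y' in C) \avg_(t in C)
      (f (z - t) * u (z - y) (z - y') t * v z y y')| <= 3 * e + eta.
Proof.
move=> Uf u1 v1.
pose phi z y y' := \avg_(t in C) (f (z - t) * u (z - y) (z - y') t * v z y y').
have phi1 z y y' : `|phi z y y'| <= 1.
  by apply: norm_avg_le => // t _; rewrite !normrM !mulr_ile1 ?mulr_ge0.
have := avg3_shift B0 C0 D0 BD CD phi1; rewrite distrC; set X := avg D _ => h.
rewrite -[X in `|X|](subrK X) (le_trans (ler_normD _ _)) //; apply: lerD h _.
apply: norm_le_pow4 => //; apply: le_trans Uf; rewrite /X exchange_avg3.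
(* Jensen brings the fourth power inside; for fixed [z], [y], [y'] only a bilinear average in [t]
   and [w] is left. *)
apply: le_trans (avg_jensen4 _ _) _; apply: ler_avg => z _.
apply: le_trans (avg_jensen4 _ _) _; apply: avg_le => // y _.
apply: le_trans (avg_jensen4 _ _) _; apply: avg_le => // y' _.
(* As [C] is symmetric, [t] may be replaced by [- t]; then [f] depends on [t + w], as
   [unorm_bilinear] expects. *)
have -> : avg D (fun w => phi (z + w) (y + w) (y' + w))
  = avg C (fun t => avg D (fun w => f (z + (t + w)) * u (z - y) (z - y') (- t)
                                     * v (z + w) (y + w) (y' + w))).
  rewrite /phi exchange_avg -(avg_opp _ CN); apply: eq_avg => t _.
  apply: eq_avg => w _; rewrite opprK; congr (f _ * u _ _ _ * _).
  - by rewrite -addrA [w + t]addrC.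
  - by rewrite opprD addrACA subrr addr0.
  - by rewrite opprD addrACA subrr addr0.
exact: (unorm_bilinear (fun x => f (z + x)) C0 D0 (fun x => u1 _ _ _)
  (fun x => v1 _ _ _)).
Qed.

End Negligible.

(** * Counting corners *)

Lemma natb_ge0 {R : realFieldType} (b : bool) : 0 <= b%:R :> R.
Proof. by case: b. Qed.

Lemma natb_le1 {R : realFieldType} (b : bool) : b%:R <= 1 :> R.
Proof. by case: b => //=; rewrite ler01. Qed.

Lemma norm_natb_le1 {R : realFieldType} (b : bool) : `|b%:R| <= 1 :> R.
Proof. by rewrite ger0_norm ?natb_ge0 ?natb_le1. Qed.

(* A corner is written [(x, y)], [(x, y2)], [(x + y2 - y, y)] with [x] in the wide set
   [B] and [y], [y2] in the narrow set [C]; the third coordinate [z = x + y2] is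
   constant along its long side, and [g z y] is the indicator function of [A] at the
   point of the antidiagonal [z] with ordinate [y]. *)
Section Count.
Variables (R : realFieldType) (G : finZmodType) (B C D : {set G}) (e eta : R).
Hypotheses (B0 : (0 < #|B|)%N) (C0 : (0 < #|C|)%N) (D0 : (0 < #|D|)%N).
Hypotheses (BC : ainv B C e) (BD : ainv B D e) (CD : ainv C D e).
Hypothesis CN : forall x, x \in C -> - x \in C.
Hypotheses (e0 : 0 <= e) (eta0 : 0 <= eta) (Ce : 1 <= e * #|C|%:R).
Variables (e1 e2 : pred G) (A : G -> G -> bool).
Hypothesis A_sub : forall x y, A x y -> e1 x && e2 y.
Hypothesis A_corner : forall x y d, A x y -> A (x + d) y -> A x (y + d) -> d = 0.

Let b1 : R := \avg_(x in B) (e1 x)%:R.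
Let b2 : R := \avg_(y in C) (e2 y)%:R.
Let al : R := \avg_(x in B) \avg_(y in C) (A x y)%:R.
Let de : R := al / (b1 * b2).
Let f x y : R := (A x y)%:R - de * (e1 x)%:R * (e2 y)%:R.
Let g z y : R := (A (z - y) y)%:R.
Let F x : R := (e1 x)%:R - b1.
Let H y : R := (e2 y)%:R - b2.
Hypothesis al0 : 0 < al.
Hypothesis UF : \avg_(z in B) unorm C D (fun x => F (z + x)) <= eta ^+ 4.
Hypothesis UH : unorm C D H <= eta ^+ 4.

Let err : R := 3 * e + eta.

Let b1_ge0 : 0 <= b1. Proof. by apply: avg_ge0 => x _; apply: natb_ge0. Qed.
Let b2_ge0 : 0 <= b2. Proof. by apply: avg_ge0 => x _; apply: natb_ge0. Qed.
Let b1_le1 : b1 <= 1. Proof. by apply: avg_le => // x _; apply: natb_le1. Qed.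
Let b2_le1 : b2 <= 1. Proof. by apply: avg_le => // x _; apply: natb_le1. Qed.

Let aE x y : (A x y)%:R = (A x y)%:R * (e1 x)%:R * (e2 y)%:R :> R.
Proof.
by have := @A_sub x y; case: A => [/(_ isT)/andP[-> ->]|_]; rewrite ?mulr1 ?mul0r.
Qed.

Let al_le : al <= b1 * b2.
Proof.
rewrite /al /b1 -avgZr; apply: ler_avg => x _; rewrite /b2 -avgZ.
apply: ler_avg => y _; rewrite aE -mulrA ler_piMl ?mulr_ge0 ?natb_ge0 //.
exact: natb_le1.
Qed.

Let bb_gt0 : 0 < b1 * b2. Proof. exact: lt_le_trans al0 al_le. Qed.
Let b1_gt0 : 0 < b1.
Proof.
by rewrite lt_neqAle b1_ge0 eq_sym andbT; apply: contraTneq bb_gt0 => ->; rewrite mul0r ltxx.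
Qed.
Let b2_gt0 : 0 < b2.
Proof.
by rewrite lt_neqAle b2_ge0 eq_sym andbT; apply: contraTneq bb_gt0 => ->; rewrite mulr0 ltxx.
Qed.
Let de_gt0 : 0 < de. Proof. exact: divr_gt0. Qed.
Let de_le1 : de <= 1. Proof. by rewrite ler_pdivrMr // mul1r. Qed.
Let alE : al = de * b1 * b2. Proof. by rewrite -mulrA divfK ?gt_eqF. Qed.

Let f_le x y : `|f x y| <= (e1 x)%:R * (e2 y)%:R.
Proof.
rewrite /f aE; case: (e1 x); case: (e2 y); rewrite ?mulr1 ?mulr0 ?subrr ?normr0 //.
case: (A x y); rewrite /= ?sub0r ?normrN ger0_norm ?subr_ge0 ?(ltW de_gt0) //.
by rewrite gerBl ltW.
Qed.
Let f1 x y : `|f x y| <= 1.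
Proof. by apply: le_trans (f_le x y) _; rewrite -[leRHS]mulr1 ler_pM ?natb_ge0 ?natb_le1. Qed.
Let g1 x y : `|g x y| <= 1. Proof. exact: norm_natb_le1. Qed.
Let sqb (b : bool) : b%:R ^+ 2 = b%:R :> R. Proof. by case: b; rewrite ?expr1n ?expr0n. Qed.
Let F1 x : `|F x| <= 1.
Proof.
rewrite /F; case: (e1 x); rewrite /= ?sub0r ?normrN ger0_norm ?subr_ge0 //.
by rewrite gerBl.
Qed.
Let H1 x : `|H x| <= 1.
Proof.
rewrite /H; case: (e2 x); rewrite /= ?sub0r ?normrN ger0_norm ?subr_ge0 //.
by rewrite gerBl.
Qed.

Let La := \avg_(x in B) \avg_(y in C) \avg_(y2 in C)
  ((A x y)%:R * (A x y2)%:R * (A (x + y2 - y) y)%:R) : R.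
Let La' := \avg_(z in B) \avg_(y in C) \avg_(y2 in C)
  ((A (z - y2) y)%:R * g z y2 * g z y) : R.
Let M : R := \avg_(z in B) (\avg_(y in C) g z y) ^+ 2.
Let Err : R := \avg_(z in B) \avg_(y in C) \avg_(y2 in C) (f (z - y2) y * g z y2 * g z y).

(** Without corners only the degenerate terms [y2 = y] survive, a proportion [1 / #|C|] of all. *)
Let La_le : La <= e.
Proof.
apply: avg_le => // x _; apply: avg_le => // y yC.
rewrite /avg ler_pdivrMr ?ltr0n //; apply: le_trans Ce.
rewrite (bigD1 y) //= big1 => [|y2 /andP[_ y2y]].
  rewrite addr0 -[leRHS]mulr1 ler_pM ?mulr_ge0 ?natb_ge0 ?natb_le1 //.
  by rewrite -[leRHS]mulr1 ler_pM ?natb_ge0 ?natb_le1.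
case h1: (A x y); rewrite ?mul0r //; case h2: (A x y2); rewrite ?mulr0 ?mul0r //.
case h3: (A _ y); rewrite ?mulr0 //.
suff /eqP: y2 - y = 0 by rewrite subr_eq0 (negPf y2y).
apply: (A_corner h1); first by rewrite addrA.
by rewrite addrC subrK.
Qed.

Let La_close : `|La - La'| <= e.
Proof.
rewrite /La /La' exchange_avg [X in _ - X]exchange_avg; apply: avg_close => // y yC.
rewrite exchange_avg [X in _ - X]exchange_avg; apply: avg_close => // y2 y2C.
pose h x : R := (A x y)%:R * (A x y2)%:R * (A (x + y2 - y) y)%:R.
rewrite distrC.
have -> : \avg_(x in B) ((A (x - y2) y)%:R * g x y2 * g x y) = \avg_(x in B) h (x + - y2).
  by apply: eq_avg => x _; rewrite /h subrK.
apply: (ainv_avg _ BC) => //; first exact: CN.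
by move=> x; rewrite /h !normrM !mulr_ile1 ?mulr_ge0 ?norm_natb_le1.
Qed.

(** The factors [g z y2] and [g z y] already force [e1 (z - y2)] and [e2 y], so the main part of
    [A (z - y2) y] contributes exactly [de]. *)
Let La'E : La' = de * M + Err.
Proof.
rewrite /La' /M /Err -avgZ -avgD; apply: eq_avg => z _.
rewrite expr2 -avgZ -avgZ -avgD; apply: eq_avg => y _.
rewrite -avgZr -avgZ -avgD; apply: eq_avg => y2 _.
have h1 : g z y = (e2 y)%:R * g z y.
  by rewrite /g aE; case: (e2 y); rewrite ?mul1r ?mulr0.
have h2 : g z y2 = (e1 (z - y2))%:R * g z y2.
  by rewrite /g aE; case: (e1 _); rewrite ?mul1r // mulr0 !mul0r.
have h3 : (e1 (z - y2))%:R * (e2 y)%:R * (g z y2 * g z y) = g z y2 * g z y.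
  by rewrite mulrACA -h1 -h2.
rewrite /f -h3; ring.
Qed.

Let rbar := \avg_(z in B) \avg_(y in C) g z y.
Let rbar_close : `|rbar - al| <= e.
Proof.
rewrite /rbar /al exchange_avg [X in _ - X]exchange_avg.
apply: avg_close => // y yC.
apply: (ainv_avg (f := fun x => (A x y)%:R) B0 BC) => [|x]; first exact: CN.
exact: norm_natb_le1.
Qed.

Let M_ge : rbar ^+ 2 <= M. Proof. exact: avg_jensen. Qed.

Variable s : R.
Hypotheses (s0 : 0 <= s) (s_small : s <= de ^+ 10 * b1 ^+ 2 * b2 ^+ 4 / 128 / 128).
Hypothesis err_s : 3 * e + 2 * eta <= s ^+ 2.

Let mono i j k i' j' k' : (i' <= i)%N -> (j' <= j)%N -> (k' <= k)%N ->
  de ^+ i * b1 ^+ j * b2 ^+ k <= de ^+ i' * b1 ^+ j' * b2 ^+ k'.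
Proof.
move=> ii jj kk; have h (x : R) m n : 0 <= x -> x <= 1 -> (m <= n)%N -> x ^+ n <= x ^+ m.
  by move=> x0 x1 mn; apply: ler_wiXn2l.
rewrite ler_pM ?mulr_ge0 ?exprn_ge0 ?(ltW de_gt0) //; last exact: h.
by rewrite ler_pM ?exprn_ge0 ?(ltW de_gt0) // h // ltW.
Qed.

(** The error is at most [s ^ 2], hence at most the square of the monomial bounding [s], which
    covers every monomial met below. The root [s] itself serves where a mean square is turned into a
    mean absolute value. *)
Let err_le_mono i j k : (i <= 20)%N -> (j <= 4)%N -> (k <= 8)%N ->
  (3 * e + 2 * eta) * 4096 <= de ^+ i * b1 ^+ j * b2 ^+ k.
Proof.
move=> i20 j4 k8; apply: le_trans (mono i20 j4 k8).
have -> : de ^+ 20 * b1 ^+ 4 * b2 ^+ 8 = (de ^+ 10 * b1 ^+ 2 * b2 ^+ 4) ^+ 2 by ring.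
have h : s ^+ 2 <= (de ^+ 10 * b1 ^+ 2 * b2 ^+ 4 / 128 / 128) ^+ 2.
  by apply: lerXn2r => //; rewrite nnegrE // (le_trans s0).
have := sqr_ge0 (de ^+ 10 * b1 ^+ 2 * b2 ^+ 4); move: err_s h.
set X := de ^+ 10 * _ * _; lra.
Qed.

Let e_small : 8 * e <= de * al ^+ 2.
Proof.
have -> : de * al ^+ 2 = de ^+ 3 * b1 ^+ 2 * b2 ^+ 2 by rewrite alE; ring.
have := err_le_mono (i := 3) (j := 2) (k := 2) isT isT isT; move: e0 eta0; lra.
Qed.

Let al_le1 : al <= 1.
Proof. by apply: le_trans al_le _; rewrite mulr_ile1. Qed.
Let e_al : e <= al.
Proof.
apply: le_trans (_ : 8 * e <= _); first by move: e0; lra.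
apply: le_trans e_small _; rewrite expr2 mulrA ler_piMl ?(ltW al0) //.
by rewrite mulr_ile1 // ltW.
Qed.

(** [La'] is [O(e)] for a corner-free set, while [de * M] is about [de * al ^ 2] at least; [Err] has
    to compensate. *)
Let Err_le : Err <= - (de * al ^+ 2 / 2).
Proof.
have h1 : al ^+ 2 - 2 * e <= M.
  apply: le_trans M_ge.
  have h : al - e <= rbar by move: rbar_close; rewrite ler_norml; lra.
  have h' : (al - e) ^+ 2 <= rbar ^+ 2.
    by rewrite lerXn2r // ?nnegrE; move: e_al h; lra.
  apply: le_trans h'; rewrite sqrrB.
  have : al * e <= e by rewrite ler_piMl.
  have := sqr_ge0 e; lra.
have h2 : de * (al ^+ 2 - 2 * e) <= de * M by rewrite ler_wpM2l // ltW.
have h3 : de * e <= e by rewrite ler_piMl.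
move: La_close La_le La'E e_small h2 h3; rewrite ler_norml mulrBr; lra.
Qed.

(* Cauchy-Schwarz in [(z, y)] has removed the factor [g z y] of [Err]. *)
Let P := \avg_(z in B) \avg_(y in C)
  ((e1 (z - y))%:R * (\avg_(y2 in C) (f (z - y2) y * g z y2)) ^+ 2).

(** The weight [e1 (z - y)], retained from [g z y], will produce the factor [b1] in front of [P0];
    without it the final bound would be too small by a power of [b1]. *)
Let P_ge : de ^+ 2 * al ^+ 3 / 8 <= P.
Proof.
have h1 : (de * al ^+ 2 / 2) ^+ 2 <= Err ^+ 2.
  have d0 : 0 <= de * al ^+ 2 by rewrite mulr_ge0 ?sqr_ge0 ?(ltW de_gt0).
  rewrite -[Err ^+ 2]sqrrN; apply: lerXn2r; rewrite ?nnegrE; move: Err_le d0; lra.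
have h2 : Err ^+ 2 <= rbar * P.
  have -> : Err = \avg_(z in B) \avg_(y in C)
     (g z y * (g z y * \avg_(y2 in C) (f (z - y2) y * g z y2))).
    apply: eq_avg => z _; apply: eq_avg => y _.
    by rewrite avgZr mulrA -expr2 sqb mulrC.
  apply: le_trans (avg2_cs _ _ _ _) _.
  have -> : \avg_(z in B) \avg_(y in C) g z y ^+ 2 = rbar.
    by apply: eq_avg => z _; apply: eq_avg => y _; rewrite sqb.
  apply: ler_wpM2l; first by do 2!(apply: avg_ge0 => ? _); apply: natb_ge0.
  apply: ler_avg => z _; apply: ler_avg => y _.
  rewrite exprMn sqb ler_wpM2r ?sqr_ge0 // /g aE -mulrA mulrCA ler_piMr ?natb_ge0 //.
  by rewrite -[leRHS]mulr1 ler_pM ?natb_ge0 ?natb_le1.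
have P0 : 0 <= P.
  by do 2!(apply: avg_ge0 => ? _); rewrite mulr_ge0 ?natb_ge0 ?sqr_ge0.
have h3 : rbar * P <= 2 * al * P.
  by rewrite ler_wpM2r //; move: rbar_close e_al; rewrite ler_norml; lra.
have h4 := le_trans h1 (le_trans h2 h3).
rewrite -(ler_pM2l (_ : 0 < 2 * al)); last by rewrite mulr_gt0.
by apply: le_trans h4; rewrite le_eqVlt; apply/orP; left; apply/eqP; field.
Qed.

Let sqr_avg (h : G -> R) :
  (\avg_(y in C) h y) ^+ 2 = \avg_(y in C) \avg_(y' in C) (h y * h y').
Proof. by rewrite expr2 -avgZr; apply: eq_avg => y _; rewrite avgZ. Qed.

Let T x x' : R := \avg_(y in C) (f x y * f x' y).
(* Replacing the weight [e1 (z - y)] of [P] by its mean [b1] costs [P1]. *)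
Let P0 := \avg_(z in B) \avg_(y in C) \avg_(y' in C)
  (g z y * g z y' * T (z - y) (z - y')).
Let P1 := \avg_(z in B) \avg_(y in C) \avg_(y' in C) \avg_(t in C)
  (F (z - t) * (f (z - y) t * f (z - y') t) * (g z y * g z y')).

Let PE : P = b1 * P0 + P1.
Proof.
rewrite /P /P0 /P1 -avgZ -avgD; apply: eq_avg => z _.
transitivity (\avg_(t in C) \avg_(y in C) \avg_(y' in C)
  ((b1 + F (z - t)) * (f (z - y) t * f (z - y') t) * (g z y * g z y'))).
  apply: eq_avg => t _; rewrite sqr_avg -avgZ; apply: eq_avg => y _.
  rewrite -avgZ; apply: eq_avg => y' _; rewrite /F; ring.
rewrite exchange_avg -avgZ -avgD; apply: eq_avg => y _.
rewrite exchange_avg -avgZ -avgD; apply: eq_avg => y' _.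
rewrite -2!avgZ -avgD; apply: eq_avg => t _; ring.
Qed.

Let P1_le : `|P1| <= err.
Proof.
apply: (avg_uniform_negligible B0 C0 D0 BD CD CN F1 eta0
  (u := fun x x' t => f x t * f x' t) (v := fun z y y' => g z y * g z y')) => //.
  by move=> *; rewrite normrM mulr_ile1.
by move=> *; rewrite normrM mulr_ile1.
Qed.

Let P0_ge : de ^+ 2 * al ^+ 3 / 16 <= b1 * P0.
Proof.
have := P1_le; rewrite ler_norml => /andP[_ h1].
have := err_le_mono (i := 5) (j := 3) (k := 3) isT isT isT.
have -> : de ^+ 5 * b1 ^+ 3 * b2 ^+ 3 = de ^+ 2 * al ^+ 3 by rewrite alE; ring.
by move: h1 P_ge PE e0 eta0; rewrite /err; lra.
Qed.

(** The expanded square is an average over two variables of [C]; averaging over an idle third one,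
    [y'], gives it the shape of [avg_uniform_negligible]. *)
Let uavg_sqr_le (v : G -> R) : (forall x, `|v x| <= 1) ->
  \avg_(z in B) (\avg_(y in C) (F (z - y) * v y)) ^+ 2 <= err.
Proof.
move=> v1; apply: le_trans (ler_norm _) _.
rewrite [X in `|X|](_ : _ = \avg_(z in B) \avg_(y in C) \avg_(y' in C) \avg_(t in C)
  (F (z - t) * v t * (F (z - y) * v y))).
  apply: (avg_uniform_negligible B0 C0 D0 BD CD CN F1 eta0
    (u := fun x x' t => v t) (v := fun z y y' => F (z - y) * v y)) => //.
  by move=> *; rewrite normrM mulr_ile1.
apply: eq_avg => z _; rewrite sqr_avg exchange_avg; apply: eq_avg => y _.
by rewrite avg_cst.
Qed.

(** Bounding [g z y] by [e1 (z - y) * e2 y] and splitting [e1] into [b1 + F] leaves [b1 * b2] plus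
    an average of [F] that is small in mean square. *)
Let M_le : M <= 3 * b1 ^+ 2 * b2 ^+ 2.
Proof.
pose m z := \avg_(y in C) (F (z - y) * (e2 y)%:R).
have hM : M <= \avg_(z in B) (2 * (b1 * b2) ^+ 2 + 2 * m z ^+ 2).
  apply: ler_avg => z _; apply: (@le_trans _ _ ((b1 * b2 + m z) ^+ 2)).
    have g0 : 0 <= \avg_(y in C) g z y by apply: avg_ge0 => y _; apply: natb_ge0.
    have h : \avg_(y in C) g z y <= b1 * b2 + m z.
      rewrite /b2 -avgZ -avgD; apply: ler_avg => y _.
      rewrite -mulrDl addrC subrK /g aE -mulrA ler_piMl ?mulr_ge0 ?natb_ge0 //.
      exact: natb_le1.
    by apply: lerXn2r (h); rewrite nnegrE // (le_trans g0).
  by have := sqr_ge0 (b1 * b2 - m z); rewrite sqrrB sqrrD; lra.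
apply: le_trans hM _; rewrite avgD avg_cst // avgZ.
have h : \avg_(z in B) m z ^+ 2 <= err.
  exact: (uavg_sqr_le (v := fun y => (e2 y)%:R) (fun y => norm_natb_le1 _)).
have := err_le_mono (i := 0) (j := 2) (k := 2) isT isT isT.
by move: h e0 eta0; rewrite /err; lra.
Qed.

(* Cauchy-Schwarz in [(z, y, y')] has removed the factor [g z y * g z y'] of [P0]. *)
Let Rr := \avg_(z in B) \avg_(y in C) \avg_(y' in C)
  ((e2 y)%:R * (e2 y')%:R * T (z - y) (z - y') ^+ 2) : R.

Let P0_sqr : P0 ^+ 2 <= M * Rr.
Proof.
have -> : P0 = \avg_(z in B) \avg_(y in C) \avg_(y' in C)
  ((g z y * g z y') * (g z y * g z y' * T (z - y) (z - y'))).
  apply: eq_avg => z _; apply: eq_avg => y _; apply: eq_avg => y' _.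
  by transitivity (g z y ^+ 2 * g z y' ^+ 2 * T (z - y) (z - y'));
    [rewrite !sqb | ring].
apply: le_trans (avg3_cs _ _ _ _ _) _.
have -> : \avg_(z in B) \avg_(y in C) \avg_(y' in C) (g z y * g z y') ^+ 2 = M.
  apply: eq_avg => z _; rewrite sqr_avg; apply: eq_avg => y _.
  by apply: eq_avg => y' _; rewrite exprMn !sqb.
apply: ler_wpM2l; first by apply: avg_ge0 => z _; apply: sqr_ge0.
do 3!(apply: ler_avg => ? _).
rewrite exprMn ler_wpM2r ?sqr_ge0 // exprMn !sqb.
by rewrite ler_pM ?natb_ge0 // /g aE ler_piMl ?natb_ge0 // -[leRHS]mulr1 ler_pM ?natb_ge0 ?natb_le1.
Qed.

(** Since [al = de * b1 * b2], the square of [de ^ 2 * al ^ 3] is [de ^ 10 * (b1 * b2) ^ 6];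
    dividing by [b1 ^ 2] and by the bound on [M] gives the monomial. This is the origin of the
    exponent 10. *)
Let Rr_ge : de ^+ 10 * b1 ^+ 2 * b2 ^+ 4 / 768 <= Rr.
Proof.
have R0 : 0 <= Rr.
  by do 3!(apply: avg_ge0 => ? _); rewrite mulr_ge0 ?sqr_ge0 ?mulr_ge0 ?natb_ge0.
have h1 : (de ^+ 2 * al ^+ 3 / 16) ^+ 2 <= (b1 * P0) ^+ 2.
  have p : 0 <= de ^+ 2 * al ^+ 3 / 16.
    by apply: divr_ge0 => //; apply: mulr_ge0; apply: exprn_ge0; apply: ltW.
  by apply: lerXn2r (P0_ge); rewrite nnegrE // (le_trans p).
have h2 : (b1 * P0) ^+ 2 <= b1 ^+ 2 * (3 * b1 ^+ 2 * b2 ^+ 2 * Rr).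
  rewrite exprMn ler_wpM2l ?sqr_ge0 // (le_trans P0_sqr) //.
  exact: ler_wpM2r M_le.
rewrite -(ler_pM2l (_ : 0 < 3 * b1 ^+ 4 * b2 ^+ 2)); last first.
  by do 2!apply: mulr_gt0; rewrite ?exprn_gt0 ?ltr0n.
have -> : 3 * b1 ^+ 4 * b2 ^+ 2 * Rr = b1 ^+ 2 * (3 * b1 ^+ 2 * b2 ^+ 2 * Rr) by ring.
apply: le_trans h2; apply: le_trans h1.
by rewrite alE le_eqVlt; apply/orP; left; apply/eqP; field.
Qed.

Let uavg_H (v : G -> R) : (forall x, `|v x| <= 1) ->
  \avg_(y in C) `|\avg_(w in D) (H (y + w) * v w)| <= eta.
Proof.
move=> v1; apply: le_trans (ler_norm _) _; apply: norm_le_pow4 => //.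
apply: le_trans UH; pose h y := \avg_(w in D) (H (y + w) * v w).
(* The sign of the inner average, taken as [u], turns a mean of absolute values into a bilinear
   average. *)
apply: le_trans (unorm_bilinear H C0 D0 (u := fun y => Num.sg (h y)) _ v1); last first.
  by move=> y; rewrite normr_sg; case: (_ == _); rewrite /= ?ler01.
rewrite le_eqVlt; apply/orP; left; apply/eqP; congr (_ ^+ 4).
apply: eq_avg => y _; rewrite normrEsg -avgZ; apply: eq_avg => w _.
by rewrite mulrCA mulrA.
Qed.

Let T1 x x' : `|T x x'| <= 1.
Proof. by apply: norm_avg_le => // y _; rewrite normrM mulr_ile1. Qed.
Let Tsqr1 x x' : `|T x x' ^+ 2| <= 1. Proof. by rewrite normrX exprn_ile1. Qed.

(* [R2] averages over [z] the box norm of [f] on [(z - C) x C]; the weights [e2] of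
   [Rr] are replaced by [b2]. *)
Let R2 := \avg_(z in B) \avg_(y in C) \avg_(y' in C) T (z - y) (z - y') ^+ 2.

(** Translating [z], [y], [y'] by a common [w] fixes [T (z - y) (z - y')] and moves only the
    weights. Writing [e2 = b2 + H] in one weight and then in the other leaves [b2 ^ 2] and two
    averages of [H] controlled by [uavg_H]. *)
Let Rr_le : Rr <= 3 * e + 2 * eta + b2 ^+ 2 * R2.
Proof.
pose phi z y y' : R := (e2 y)%:R * (e2 y')%:R * T (z - y) (z - y') ^+ 2.
have phi1 z y y' : `|phi z y y'| <= 1.
  rewrite normrM mulr_ile1 // normrM mulr_ile1 ?norm_natb_le1 //.
have := avg3_shift B0 C0 D0 BD CD phi1.
rewrite -/Rr exchange_avg3; set X := avg B _ => hX.
suff h : X <= \avg_(z in B) \avg_(y in C) \avg_(y' in C)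
   (b2 ^+ 2 * T (z - y) (z - y') ^+ 2
    + `|\avg_(w in D) (H (y' + w) * 1)|
    + `|\avg_(w in D) (H (y + w) * (e2 (y' + w))%:R)|).
  have e1' : \avg_(y in C) \avg_(y' in C) `|\avg_(w in D) (H (y' + w) * 1)| <= eta.
    by rewrite avg_cst // uavg_H // => x; rewrite normr1.
  have e2' : \avg_(y in C) \avg_(y' in C)
      `|\avg_(w in D) (H (y + w) * (e2 (y' + w))%:R)| <= eta.
    rewrite exchange_avg; apply: avg_le => // y' _.
    by apply: (uavg_H (v := fun w => (e2 (y' + w))%:R)) => x; apply: norm_natb_le1.
  have h' : X <= \avg_(z in B) (b2 ^+ 2 *
      (\avg_(y in C) \avg_(y' in C) T (z - y) (z - y') ^+ 2) + (eta + eta)).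
    apply: le_trans h _; apply: ler_avg => z _.
    suff -> : \avg_(y in C) \avg_(y' in C)
        (b2 ^+ 2 * T (z - y) (z - y') ^+ 2
         + `|\avg_(w in D) (H (y' + w) * 1)|
         + `|\avg_(w in D) (H (y + w) * (e2 (y' + w))%:R)|)
      = b2 ^+ 2 * (\avg_(y in C) \avg_(y' in C) T (z - y) (z - y') ^+ 2)
        + (\avg_(y in C) \avg_(y' in C) `|\avg_(w in D) (H (y' + w) * 1)|
           + \avg_(y in C) \avg_(y' in C)
               `|\avg_(w in D) (H (y + w) * (e2 (y' + w))%:R)|).
      by rewrite lerD2l; apply: (lerD e1' e2').
    rewrite -avgZ addrA -2!avgD; apply: eq_avg => y _.
    by rewrite -avgZ -2!avgD.
  move: h'; rewrite avgD avg_cst // avgZ -/R2; move: hX; rewrite ler_norml; lra.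
apply: ler_avg => z _; apply: ler_avg => y _; apply: ler_avg => y' _.
have -> : \avg_(w in D) phi (z + w) (y + w) (y' + w) = T (z - y) (z - y') ^+ 2 *
  (b2 ^+ 2 + b2 * (\avg_(w in D) (H (y' + w) * 1))
     + \avg_(w in D) (H (y + w) * (e2 (y' + w))%:R)).
  rewrite -avgZ -(avg_cst (b2 ^+ 2) D0) -2!avgD -avgZ; apply: eq_avg => w _.
  rewrite /phi !(opprD, addrACA _ w) !subrr !addr0 /H; ring.
have le1 (x a : R) : `|a| <= 1 -> a * x <= `|x|.
  by move=> a1; apply: le_trans (ler_norm _) _; rewrite normrM ler_piMl.
rewrite !mulrDr; apply: lerD; first apply: lerD; last exact: le1.
  by rewrite mulrC.
by rewrite mulrA le1 // normrM mulr_ile1 // ger0_norm.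
Qed.

Let R2_ge : de ^+ 10 * b1 ^+ 2 * b2 ^+ 2 / 1536 <= R2.
Proof.
rewrite -(ler_pM2l (_ : 0 < b2 ^+ 2)) ?exprn_gt0 //.
have := err_le_mono (i := 10) (j := 2) (k := 4) isT isT isT.
have -> : b2 ^+ 2 * (de ^+ 10 * b1 ^+ 2 * b2 ^+ 2 / 1536)
  = de ^+ 10 * b1 ^+ 2 * b2 ^+ 4 / 1536 by ring.
by move: Rr_ge Rr_le e0 eta0; lra.
Qed.

Variable ka : R.
Hypotheses (ka0 : 0 <= ka) (ka_small : ka <= de ^+ 10 / 256 / 128).

(** * Upper bound for the box norm in the absence of an increment *)

Section NoIncrement.
Hypothesis no_incr : forall (z : G) (v u : pred G),
  (forall x, v x -> e1 x) -> (forall y, u y -> e2 y) ->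
  \avg_(x in C) \avg_(y in C)
    ((A (z + x) y && (v (z + x) && u y))%:R - (de + ka) * (v (z + x) && u y)%:R)
  < ka * b1 * b2.

Let rho z : R := \avg_(x in C) (e1 (z - x))%:R.
Let fbar z : R := \avg_(x in C) \avg_(y in C) f (z - x) y.
Let bound z : R := 2 * ka * (rho z * b2 + 4 * (b1 * b2)) - fbar z.

(* Without an increment [f] has no large positive mass on product sets; the mean
   [fbar z] then limits the negative mass too. *)
Let part_le z (v u : pred G) :
  (forall x, v x -> e1 x) -> (forall y, u y -> e2 y) ->
  `|\avg_(x in C) \avg_(y in C) (f (z - x) y * (v (z - x))%:R * (u y)%:R)|
  <= 2 * ka * (\avg_(x in C) \avg_(y in C) ((v (z - x))%:R * (u y)%:R) + b1 * b2)
     - \avg_(x in C) \avg_(y in C) (f (z - x) y * (v (z - x))%:R * (u y)%:R).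
Proof.
move=> ve ue; set p := avg _ _; set n := avg _ _.
have n0 : 0 <= n by do 2!(apply: avg_ge0 => ? _); rewrite mulr_ge0 ?natb_ge0.
have q0 : 0 <= ka * (n + b1 * b2) by rewrite mulr_ge0 // addr_ge0 // ltW.
suff : p <= ka * (n + b1 * b2) by move=> h; rewrite ler_norml; lra.
have := no_incr z ve ue; rewrite -(avg_opp _ CN).
rewrite (_ : avg _ _ = p - ka * n); first lra.
rewrite /p /n -avgZ -avgB; apply: eq_avg => x _.
rewrite -avgZ -avgB; apply: eq_avg => y _.
have := ve (z - x); have := ue y; rewrite /f.
case: (v _); case: (u y); rewrite ?andbT ?andbF /= => hu hv;
  rewrite ?mulr1 ?mulr0 ?subrr //.
by rewrite hu // hv // !mulr1; ring.
Qed.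

(** On [e2] the function [f x'] takes only the values [1 - de] and [- de], and likewise [f] at
    ordinate [y'] on [e1]. So the average combines those of [f] over four product sets, with
    coefficients of absolute value at most 1; the sets partition [e1] times [e2], and the four
    bounds of [part_le] add up to [bound z]. *)
Let test_le z x' y' : e1 x' -> e2 y' ->
  `|\avg_(x in C) \avg_(y in C) (f (z - x) y * f x' y * f (z - x) y')| <= bound z.
Proof.
move=> ex' ey'.
pose v1 x := A x y'; pose v0 x := e1 x && ~~ A x y'.
pose u1 y := A x' y; pose u0 y := e2 y && ~~ A x' y.
have hv1 x : v1 x -> e1 x by move=> /A_sub/andP[].
have hu1 y : u1 y -> e2 y by move=> /A_sub/andP[].
have hv0 x : v0 x -> e1 x by move=> /andP[].
have hu0 y : u0 y -> e2 y by move=> /andP[].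
have := part_le z hv1 hu1; have := part_le z hv1 hu0.
have := part_le z hv0 hu1; have := part_le z hv0 hu0.
pose p (v u : pred G) := \avg_(x in C) \avg_(y in C) (f (z - x) y * (v (z - x))%:R * (u y)%:R).
pose n (v u : pred G) : R := \avg_(x in C) \avg_(y in C) ((v (z - x))%:R * (u y)%:R).
rewrite -!/(p _ _) -!/(n _ _).
have eq_p : fbar z = p v1 u1 + p v1 u0 + p v0 u1 + p v0 u0.
  rewrite /p -!avgD; apply: eq_avg => x _; rewrite -!avgD; apply: eq_avg => y _.
  rewrite /v1 /v0 /u1 /u0 /f; have := @A_sub (z - x) y; have := @A_sub x' y.
  have := @A_sub (z - x) y'.
  case: (A (z - x) y); case: (A x' y); case: (A (z - x) y'); case: (e1 (z - x)); case: (e2 y);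
    rewrite /= ?ex' ?ey' => h h2 h3; try (by move: (h isT)); try (by move: (h2 isT));
    try (by move: (h3 isT)); ring.
have eq_n : rho z * b2 = n v1 u1 + n v1 u0 + n v0 u1 + n v0 u0.
  rewrite /n /rho /b2 -avgZr -!avgD; apply: eq_avg => x _.
  rewrite -avgZ -!avgD; apply: eq_avg => y _.
  rewrite /v1 /v0 /u1 /u0; have := @A_sub x' y; have := @A_sub (z - x) y'.
  case: (A x' y); case: (A (z - x) y'); case: (e1 (z - x)); case: (e2 y);
    rewrite /= ?ex' ?ey' => h h2; try (by move: (h isT)); try (by move: (h2 isT)); ring.
have -> : \avg_(x in C) \avg_(y in C) (f (z - x) y * f x' y * f (z - x) y')
  = (1 - de) ^+ 2 * p v1 u1 - (1 - de) * de * p v1 u0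
    - (1 - de) * de * p v0 u1 + de ^+ 2 * p v0 u0.
  rewrite /p -!avgZ -!avgB -!avgD; apply: eq_avg => x _.
  rewrite -!avgZ -!avgB -!avgD; apply: eq_avg => y _.
  rewrite /v1 /v0 /u1 /u0 /f; have := @A_sub (z - x) y; have := @A_sub x' y.
  have := @A_sub (z - x) y'; rewrite ex' ey'.
  case: (A (z - x) y); case: (A x' y); case: (A (z - x) y'); case: (e1 (z - x)); case: (e2 y);
    rewrite /= => h h2 h3; try (by move: (h isT)); try (by move: (h2 isT));
    try (by move: (h3 isT)); ring.
have coef (c x : R) : 0 <= c -> c <= 1 -> `|c * x| <= `|x|.
  by move=> c0 c1; rewrite normrM ger0_norm // ler_piMl.
have d0 : 0 <= 1 - de by rewrite subr_ge0.
have d1 : 1 - de <= 1 by rewrite gerBl ltW.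
have d2 := ltW de_gt0.
have c11 := coef _ (p v1 u1) (sqr_ge0 (1 - de)) (exprn_ile1 2 d0 d1).
have c00 := coef _ (p v0 u0) (sqr_ge0 de) (exprn_ile1 2 d2 de_le1).
have c10 := coef _ (p v1 u0) (mulr_ge0 d0 d2) (mulr_ile1 d0 d2 d1 de_le1).
have c01 := coef _ (p v0 u1) (mulr_ge0 d0 d2) (mulr_ile1 d0 d2 d1 de_le1).
move=> h00 h01 h10 h11; rewrite /bound eq_p eq_n.
apply: le_trans (ler_normD _ _) _; apply: le_trans (lerD (ler_normB _ _) (lexx _)) _.
apply: le_trans (lerD (lerD (ler_normB _ _) (lexx _)) (lexx _)) _.
lra.
Qed.

Let rho_ge0 z : 0 <= rho z. Proof. by apply: avg_ge0 => x _; apply: natb_ge0. Qed.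
Let rho_le1 z : rho z <= 1. Proof. by apply: avg_le => // x _; apply: natb_le1. Qed.

(** One vertex [(z - y', t')] of each box is fixed. It must lie in [e1] times [e2], whence the
    factor [rho z * b2]; the other three vertices form the average of [test_le]. *)
Let R2_le : R2 <= \avg_(z in B) (rho z * b2 * bound z).
Proof.
apply: ler_avg => z _; rewrite exchange_avg -mulrA /rho -avgZr; apply: ler_avg => y' _.
have -> : \avg_(y in C) T (z - y) (z - y') ^+ 2 = \avg_(t' in C) (f (z - y') t' *
   \avg_(y in C) \avg_(t in C) (f (z - y) t * f (z - y') t * f (z - y) t')).
  transitivity (\avg_(y in C) \avg_(t' in C) \avg_(t in C)
    (f (z - y') t' * (f (z - y) t * f (z - y') t * f (z - y) t'))).
    apply: eq_avg => y _; rewrite sqr_avg exchange_avg; apply: eq_avg => t' _.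
    by apply: eq_avg => t _; ring.
  rewrite exchange_avg; apply: eq_avg => t' _; rewrite -avgZ; apply: eq_avg => y _.
  by rewrite avgZ.
rewrite /b2 mulrCA -avgZr; apply: ler_avg => t' _.
apply: le_trans (ler_norm _) _; rewrite normrM.
have := f_le (z - y') t'; case h1: (e1 (z - y')); last first.
  by rewrite !mul0r mulr0 normr_le0 => /eqP ->; rewrite normr0 !mul0r.
case h2: (e2 t'); last by rewrite !mulr0 normr_le0 => /eqP ->; rewrite normr0 !mul0r.
move=> h; rewrite !mul1r; apply: le_trans (test_le z h1 h2).
by rewrite ler_piMl.
Qed.

Let Fb z : R := \avg_(y in C) (F (z - y) * 1).

Let rhoE z : rho z = b1 + Fb z.
Proof.
rewrite /rho /Fb /F -(avg_cst b1 C0) -avgD; apply: eq_avg => x _.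
by rewrite avg_cst //; ring.
Qed.

Let Fb_small : \avg_(z in B) `|Fb z| <= s.
Proof.
have h : \avg_(z in B) Fb z ^+ 2 <= err.
  by apply: (uavg_sqr_le (v := fun=> 1)) => x; rewrite normr1.
have h2 : (\avg_(z in B) `|Fb z|) ^+ 2 <= s ^+ 2.
  apply: le_trans (avg_jensen _ _) _.
  under eq_avg do rewrite real_normK ?num_real //.
  by move: h err_s eta0; rewrite /err; lra.
by rewrite -(@ler_pXn2r _ 2) ?nnegrE // avg_ge0 // => z _; rewrite normr_ge0.
Qed.

Let ka_le : ka <= 256^-1 / 128.
Proof.
have : de ^+ 10 <= 1 by rewrite exprn_ile1 // ltW.
by move: ka_small; lra.
Qed.

Let bound_le z : `|bound z| <= 2.
Proof.
have h1 : `|fbar z| <= 1 by do 2!(apply: norm_avg_le => // ? _).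
have h2 : 0 <= rho z * b2 + 4 * (b1 * b2) <= 5.
  have := mulr_ge0 (rho_ge0 z) b2_ge0; have := mulr_ile1 (rho_ge0 z) b2_ge0 (rho_le1 z) b2_le1.
  have := mulr_ge0 b1_ge0 b2_ge0; have := mulr_ile1 b1_ge0 b2_ge0 b1_le1 b2_le1; lra.
have h3 : 0 <= ka * (rho z * b2 + 4 * (b1 * b2)) <= 256^-1 / 128 * 5.
  case/andP: h2 => h2 h2'; rewrite mulr_ge0 //=.
  by apply: ler_pM.
move: h1 h3; rewrite /bound !ler_norml; lra.
Qed.

(** [f] has mean zero on [B] times [C], so the term [fbar z], which paid for the negative mass,
    disappears on averaging up to [e]. *)
Let avg_bound : \avg_(z in B) bound z <= 10 * ka * (b1 * b2) + 2 * e.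
Proof.
have hr : \avg_(z in B) rho z <= b1 + e.
  suff : `|\avg_(z in B) rho z - b1| <= e by rewrite ler_norml; lra.
  rewrite /rho exchange_avg -[X in `|_ - X|](avg_cst _ C0); apply: avg_close => // x xC.
  by apply: (ainv_avg (f := fun x => (e1 x)%:R) B0 BC (CN xC)) => y; apply: norm_natb_le1.
have hf : `|\avg_(z in B) fbar z| <= e.
  have f0 : \avg_(x in B) \avg_(y in C) f x y = 0.
    transitivity (al - de * b1 * b2); last by rewrite alE subrr.
    have -> : de * b1 * b2 = \avg_(x in B) (de * (e1 x)%:R * b2) by rewrite avgZr avgZ.
    rewrite -avgB; apply: eq_avg => x _.
    by rewrite /b2 -avgZ -avgB.
  rewrite -[X in `|X|]subr0 -f0 /fbar exchange_avg -[X in `|_ - X|](avg_cst _ C0).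
  apply: avg_close => // x xC.
  apply: (ainv_avg (f := fun x => \avg_(y in C) f x y) B0 BC (CN xC)) => z.
  exact: norm_avg_le.
have -> : \avg_(z in B) bound z
  = 2 * ka * ((\avg_(z in B) rho z) * b2 + 4 * (b1 * b2)) - \avg_(z in B) fbar z.
  by rewrite avgB avgZ avgD avgZr avg_cst.
have h2 : ka * ((\avg_(z in B) rho z) * b2) <= ka * (b1 * b2 + e).
  rewrite ler_wpM2l // (le_trans (ler_wpM2r b2_ge0 hr)) // mulrDl lerD2l.
  by rewrite ler_piMr.
have h3 : ka * e <= 256^-1 / 128 * e by rewrite ler_wpM2r.
move: hf h2 h3; rewrite ler_norml; move: e0; lra.
Qed.

(** Replacing [rho z] by [b1] costs [2 * s]. Then both bounds for [R2] have the order
    [(b1 * b2) ^ 2], with coefficients [de ^ 10 / 1536] from below and [10 * ka] from above. *)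
Lemma no_increment_absurd : False.
Proof.
have h : R2 <= b1 * b2 * (10 * ka * (b1 * b2) + 2 * e) + 2 * s.
  apply: le_trans R2_le (le_trans (_ : _ <= \avg_(z in B) (b1 * b2 * bound z + 2 * `|Fb z|)) _).
    apply: ler_avg => z _; rewrite rhoE.
    have -> : (b1 + Fb z) * b2 * bound z = b1 * b2 * bound z + b2 * (Fb z * bound z) by ring.
    rewrite lerD2l; apply: le_trans (ler_norm _) _.
    rewrite normrM ger0_norm // normrM -[2 * _]mul1r [2 * _]mulrC.
    by rewrite ler_pM // ?mulr_ge0 // ler_pM.
  rewrite avgD !avgZ lerD //; last by rewrite ler_wpM2l.
  by rewrite ler_wpM2l // mulr_ge0.
have Y0 : 0 < de ^+ 10 * b1 ^+ 2 * b2 ^+ 2.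
  by rewrite (mulr_gt0 (mulr_gt0 _ _)) ?exprn_gt0.
have h2 : ka * (b1 * b2) ^+ 2 <= de ^+ 10 / 256 / 128 * (b1 * b2) ^+ 2.
  by rewrite ler_wpM2r ?sqr_ge0.
have h3 : s <= de ^+ 10 * b1 ^+ 2 * b2 ^+ 2 / 128 / 128.
  have := @mono 10 2 4 10 2 2 isT isT isT; move: s_small; lra.
have h4 : b1 * b2 * e <= e by rewrite ler_piMl // mulr_ile1.
have h5 : s ^+ 2 <= s.
  rewrite expr2 ler_piMl //.
  have := @mono 10 2 4 0 0 0 isT isT isT; move: s_small; rewrite !expr0; lra.
move: h R2_ge Y0 h2 h3 h4 h5 err_s eta0; lra.
Qed.

End NoIncrement.

Lemma corner_free_increment : exists (z : G) (v u : pred G),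
  [/\ forall x, v x -> e1 x, forall y, u y -> e2 y &
  ka * b1 * b2 <= \avg_(x in C) \avg_(y in C)
    ((A (z + x) y && (v (z + x) && u y))%:R - (de + ka) * (v (z + x) && u y)%:R)].
Proof.
apply: contrapT => h; apply: no_increment_absurd => z v u ve ue.
by rewrite ltNge; apply/negP => h'; apply: h; exists z, v, u.
Qed.

End Count.

(** * Characters and Bohr sets *)

Section Characters.
Variable G : finZmodType.
Implicit Types (i : Iirr [set: G]) (x y : G).

Lemma lin_chi i : 'chi_i \is a linear_char.
Proof.
by apply/char_abelianP: i; apply/centsP => x _ y _; rewrite /commute FinRing.zmodMgE addrC.
Qed.

Lemma chiD i x y : 'chi_i (x + y) = 'chi_i x * 'chi_i y.
Proof. by rewrite -FinRing.zmodMgE (lin_charM (lin_chi i)) ?inE. Qed.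

Lemma norm_chi i x : `|'chi_i x| = 1.
Proof. by rewrite normC_lin_char ?lin_chi ?inE. Qed.

Lemma chi0 i : 'chi_i (0 : G) = 1.
Proof. by rewrite -(lin_char1 (lin_chi i)). Qed.

Lemma chiN i x : 'chi_i (- x) = ('chi_i x)^*.
Proof.
apply: (@mulfI _ ('chi_i x)); first by rewrite -normr_eq0 norm_chi oner_eq0.
by rewrite -chiD subrr chi0 -normCK norm_chi expr1n.
Qed.

Lemma sum_chi x : \sum_i 'chi[[set: G]]_i x = (#|G| * (x == 0))%:R.
Proof.
have := second_orthogonality_relation x (in_setT (0 : G)).
under eq_bigr do rewrite chi0 rmorph1 mulr1.
move=> ->; rewrite setTI.
have -> : 'C[x]%g = [set: G].
  apply/setP=> y; rewrite [RHS]inE; apply/cent1P.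
  by rewrite /commute !FinRing.zmodMgE addrC.
rewrite cardsT -mulr_natr -natrM; congr (_ * _)%:R.
by have := class1G [group of [set: G]]; rewrite FinRing.zmod1gE => ->; rewrite inE.
Qed.

Variables (p : G -> algC) (D : {set G}).
Hypothesis p_real : forall x, p x \is Num.real.

Let c (h : G) : algC := \sum_v p v * p (v + h).
Let ph i : algC := \sum_v p v * 'chi[[set: G]]_i v.
Let Q i : algC := \sum_v `|\sum_(w in D) p (v + w) * 'chi[[set: G]]_i w| ^+ 2.

Lemma fourier_inversion (h : G) : \sum_i `|ph i| ^+ 2 * 'chi_i h = #|G|%:R * c h.
Proof.
transitivity (\sum_u \sum_v (p u * p v * \sum_i 'chi[[set: G]]_i (u - v + h))).
  transitivity (\sum_i \sum_u \sum_v (p u * p v * 'chi[[set: G]]_i (u - v + h))).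
    apply: eq_bigr => i _; rewrite normCK /ph rmorph_sum big_distrlr /= mulr_suml.
    apply: eq_bigr => u _; rewrite mulr_suml; apply: eq_bigr => v _.
    rewrite rmorphM /= (CrealP (p_real v)) -chiN !chiD; ring.
  rewrite exchange_big; apply: eq_bigr => u _; rewrite exchange_big.
  by apply: eq_bigr => v _; rewrite mulr_sumr.
rewrite mulr_sumr; apply: eq_bigr => u _; rewrite (bigD1 (u + h)) //= [X in _ + X]big1.
  by rewrite addr0 sum_chi opprD addrA subrr add0r addNr eqxx muln1; ring.
move=> v vuh; rewrite sum_chi; case: eqP; rewrite ?muln0 ?mulr0 // => e.
case/eqP: vuh; apply/eqP; rewrite -subr_eq0 -oppr_eq0 opprB.
by rewrite addrAC e.
Qed.

Lemma corrE w w' : \sum_v p (v + w) * p (v + w') = c (w - w').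
Proof.
rewrite /c (reindex_inj (addIr (- w'))) /=; apply: eq_bigr => v _.
by rewrite mulrC subrK -addrA [- _ + _]addrC.
Qed.

Lemma QE i : Q i = \sum_(w in D) \sum_(w' in D) c (w - w') * 'chi_i (w - w').
Proof.
transitivity (\sum_v \sum_(w in D) \sum_(w' in D)
   (p (v + w) * p (v + w') * 'chi[[set: G]]_i (w - w'))).
  apply: eq_bigr => v _; rewrite normCK rmorph_sum big_distrlr /=.
  apply: eq_bigr => w _; apply: eq_bigr => w' _.
  by rewrite rmorphM /= (CrealP (p_real _)) -chiN chiD; ring.
rewrite exchange_big; apply: eq_bigr => w _; rewrite exchange_big.
by apply: eq_bigr => w' _; rewrite -corrE mulr_suml.
Qed.

(* By inversion the left side is a sum over characters [i] of [Q i] weighted by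
   [|ph i|^2 / |G|], and these weights add up to the sum of [p^2]. *)
Lemma fourier_witness : exists i,
  \sum_(w in D) \sum_(w' in D) (\sum_v p (v + w) * p (v + w')) ^+ 2
  <= (\sum_v p v ^+ 2) * Q i.
Proof.
set S := \sum_(w in D) _.
have c_real h : c h \is Num.real by apply: rpred_sum => v _; apply: rpredM.
have SE : #|G|%:R * S = \sum_i `|ph i| ^+ 2 * Q i.
  transitivity (\sum_i \sum_(w in D) \sum_(w' in D)
     (c (w - w') * (`|ph i| ^+ 2 * 'chi_i (w - w')))).
    rewrite exchange_big mulr_sumr; apply: eq_bigr => w _.
    rewrite exchange_big mulr_sumr; apply: eq_bigr => w' _.
    rewrite -mulr_sumr fourier_inversion corrE; ring.
  apply: eq_bigr => i _; rewrite QE mulr_sumr; apply: eq_bigr => w _.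
  by rewrite mulr_sumr; apply: eq_bigr => w' _; ring.
have c0E : \sum_v p v ^+ 2 = c 0.
  by apply: eq_bigr => v _; rewrite addr0 expr2.
have phE : \sum_i `|ph i| ^+ 2 = #|G|%:R * c 0.
  by rewrite -fourier_inversion; apply: eq_bigr => i _; rewrite chi0 mulr1.
have S_real : S \is Num.real.
  by do 2!(apply: rpred_sum => ? _); rewrite corrE; apply: rpredX.
have Q_ge0 i : 0 <= Q i by apply: sumr_ge0 => v _; rewrite exprn_ge0.
have c0_ge0 : 0 <= c 0.
  by rewrite -c0E; apply: sumr_ge0 => v _; rewrite real_exprn_even_ge0.
have G0 : 0 < #|G|%:R :> algC by rewrite ltr0n; apply/card_gt0P; exists 0.
rewrite c0E.
apply/existsP; apply: contraT; rewrite negb_exists => /forallP h.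
have {}h i : 0 < S - c 0 * Q i.
  by rewrite subr_gt0 real_ltNge ?h // ger0_real // mulr_ge0.
have z : \sum_i `|ph i| ^+ 2 * (S - c 0 * Q i) = 0.
  under eq_bigr do rewrite mulrBr mulrCA.
  by rewrite sumrB -mulr_suml -mulr_sumr -SE phE; ring.
(* A vanishing sum of positive quantities with nonnegative weights has zero weights; then [S]
   vanishes too, and [h] fails. *)
have ph0 i : `|ph i| ^+ 2 = 0.
  have := psumr_eq0P (fun i _ => mulr_ge0 (exprn_ge0 2 (normr_ge0 (ph i))) (ltW (h i))) z.
  by move=> /(_ i isT) /eqP; rewrite mulf_eq0 (gt_eqF (h i)) orbF => /eqP.
have S0 : S = 0.
  apply/eqP; move/eqP: SE; rewrite big1 => [|i _]; last by rewrite ph0 mul0r.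
  by rewrite mulf_eq0 (gt_eqF G0).
have := h 0; rewrite S0 sub0r oppr_gt0 => hlt.
by have := le_lt_trans (mulr_ge0 c0_ge0 (Q_ge0 0)) hlt; rewrite ltxx.
Qed.

End Characters.

(** * Fourier analysis localized to an approximately invariant set *)

Section FourierIncrement.
Variables (G : finZmodType) (B D : {set G}) (e : rat) (F : G -> rat).
Hypotheses (B0 : (0 < #|B|)%N) (D0 : (0 < #|D|)%N) (e0 : 0 <= e).
Hypotheses (BD : ainv B D e) (F1 : forall x, `|F x| <= 1).

Let iB x : rat := (x \in B)%:R.
Let p x : rat := F x * iB x.
Let lv w : rat := #|leavers B w|%:R.
Let nB : rat := #|B|%:R.
Let nD : rat := #|D|%:R.

Let nB0 : 0 < nB. Proof. by rewrite ltr0n. Qed.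
Let nD0 : 0 < nD. Proof. by rewrite ltr0n. Qed.

Let lv_le w : w \in D -> 2 * lv w <= e * nB.
Proof. by move=> wD; rewrite /lv -natrM; apply: BD. Qed.

Let iB_ge0 x : 0 <= iB x. Proof. by rewrite /iB; case: (_ \in _). Qed.
Let iB_le1 x : iB x <= 1. Proof. by rewrite /iB; case: (_ \in _). Qed.
Let p_le x : `|p x| <= iB x.
Proof. by rewrite /p normrM [`|iB x|]ger0_norm // ler_piMl. Qed.
Let p1 x : `|p x| <= 1. Proof. exact: le_trans (p_le x) _. Qed.

Let sum_in w : \sum_(v in B) (1 - iB (v + w)) = lv w.
Proof.
rewrite /lv -sum1_card natr_sum [RHS]big_mkcond [LHS]big_mkcond /=.
apply: eq_bigr => v _; rewrite inE /iB.
by case: (v \in B); case: (_ \in B); rewrite /= ?subrr ?subr0.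
Qed.

Let sum_shift w : \sum_v iB (v + w) = nB.
Proof.
rewrite (reindex_inj (addIr (- w))) /=; under eq_bigr do rewrite subrK.
rewrite /nB -sum1_card natr_sum [RHS]big_mkcond.
by apply: eq_bigr => v _; rewrite /iB; case: (v \in B).
Qed.

Let sum_out w : \sum_(v in ~: B) iB (v + w) = lv w.
Proof.
have := sum_shift w; rewrite (bigID (mem B)) /= -sum_in sumrB.
under [\sum_(v in ~: B) _]eq_bigl do rewrite inE.
by rewrite sumr_const -/nB => <-; rewrite addrAC subrr add0r.
Qed.

Let corr w w' : rat := \sum_v p (v + w) * p (v + w').

Let corr_le w w' : `|corr w w'| <= nB.
Proof.
apply: le_trans (ler_norm_sum _ _ _) _; rewrite -(sum_shift w); apply: ler_sum => v _.
by rewrite normrM -[leRHS]mulr1 ler_pM.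
Qed.

Let corr_close w w' : w \in D -> w' \in D ->
  `|\avg_(y in B) (F (y + w) * F (y + w')) - corr w w' / nB| <= 3 / 2 * e.
Proof.
move=> wD w'D; rewrite /avg -/nB -mulrBl normrM normfV (gtr0_norm nB0) ler_pdivrMr //.
rewrite /corr [X in _ - X](bigID (mem B)) /= opprD addrA -sumrB.
apply: le_trans (ler_normB _ _) _.
have h1 : `|\sum_(v in B) (F (v + w) * F (v + w') - p (v + w) * p (v + w'))| <= lv w + lv w'.
  rewrite -!sum_in -big_split /=; apply: le_trans (ler_norm_sum _ _ _) _.
  apply: ler_sum => v _; rewrite /p /iB.
  have h : `|F (v + w) * F (v + w')| <= 1 by rewrite normrM mulr_ile1.
  case: (v + w \in B); case: (v + w' \in B); rewrite ?mulr1 ?mulr0 ?mul0r /=;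
    move: h; rewrite ?subrr ?normr0 ?subr0 ?addr0 ?add0r //.
  lra.
have h2 : `|\sum_(v | v \notin B) p (v + w) * p (v + w')| <= lv w.
  rewrite -sum_out; apply: le_trans (ler_norm_sum _ _ _) _.
  under [leRHS]eq_bigl do rewrite inE.
  apply: ler_sum => v _; rewrite normrM -[leRHS]mulr1 ler_pM //.
by move: (lv_le wD) (lv_le w'D) h1 h2; lra.
Qed.

(** Fourier inversion on all of [G] needs the cut-off [p] of [F]. It changes each normalized
    correlation by at most [3 / 2 * e], and its square by at most twice that. *)
Lemma unorm_le_corr :
  unorm B D F <= \avg_(w in D) \avg_(w' in D) (corr w w' / nB) ^+ 2 + 3 * e.
Proof.
rewrite -[3 * e](avg_cst _ D0) -avgD; apply: ler_avg => w wD.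
rewrite -[3 * e](avg_cst _ D0) -avgD; apply: ler_avg => w' w'D.
have := corr_close wD w'D; set a := avg _ _; set c := _ / nB => h.
have a1 : `|a| <= 1 by apply: norm_avg_le => // y _; rewrite normrM mulr_ile1.
have c1 : `|c| <= 1.
  by rewrite normrM normfV (gtr0_norm nB0) ler_pdivrMr // mul1r corr_le.
have -> : a ^+ 2 = c ^+ 2 + (a - c) * (a + c) by rewrite -subr_sqr addrC subrK.
rewrite lerD2l; apply: le_trans (ler_norm _) _; rewrite normrM.
have -> : 3 * e = 3 / 2 * e * 2 by field.
apply: ler_pM => //; apply: le_trans (ler_normD _ _) _; lra.
Qed.

Section Relative.
Variables (C : {set G}) (chi : G -> algC).
Hypotheses (C0 : (0 < #|C|)%N) (DC : ainv D C e).
Hypotheses (chiM : forall x y, chi (x + y) = chi x * chi y)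
  (chi_norm : forall x, `|chi x| = 1)
  (chi_close : forall c, c \in C -> `|chi c - 1| <= ratr e).

Let z v : rat := \avg_(w in D) `|\avg_(c in C) F (v + w + c)|.
Let o v : rat := \avg_(w in D) iB (v + w).
Let X v : algC := \avg_(w in D) (ratr (p (v + w)) * chi w).

Let ratr_avg (T : finType) (S : {set T}) (f : T -> rat) :
  ratr (avg S f) = avg S (fun x => ratr (f x)) :> algC.
Proof. by rewrite /avg rmorphM /= fmorphV rmorph_nat rmorph_sum. Qed.

Let ratr_norm (x : rat) : `|ratr x| = ratr `|x| :> algC.
Proof. by rewrite ratr_norm. Qed.

Let X_le v : `|X v| <= ratr (o v).
Proof.
apply: le_trans (norm_avg _ _) _; rewrite ratr_avg; apply: ler_avg => w _.
by rewrite normrM chi_norm mulr1 ratr_norm ler_rat.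
Qed.

Let z_ge0 v : 0 <= z v. Proof. by apply: avg_ge0. Qed.
Let z_le1 v : z v <= 1. Proof. by apply: avg_le => // w _; apply: norm_avg_le. Qed.
Let o_ge0 v : 0 <= o v. Proof. by apply: avg_ge0. Qed.
Let o_le1 v : o v <= 1. Proof. by apply: avg_le. Qed.

(** Translating [w] by [c] costs [e], replacing [chi c] by 1 another [e], and removing the cut-off
    [1 - o v]. *)
Let X_le_z v : `|X v| <= ratr (z v + (2 * e + (1 - o v))).
Proof.
pose Y := \avg_(w in D) (ratr (F (v + w)) * chi w) : algC.
have XY : `|X v - Y| <= ratr (1 - o v).
  rewrite /X /Y -avgB; apply: le_trans (norm_avg _ _) _.
  have -> : 1 - o v = \avg_(w in D) (1 - iB (v + w)) by rewrite avgB avg_cst.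
  rewrite ratr_avg; apply: ler_avg => w _.
  rewrite -mulrBl normrM chi_norm mulr1 -rmorphB ratr_norm ler_rat /p.
  have -> : F (v + w) * iB (v + w) - F (v + w) = - (F (v + w) * (1 - iB (v + w))) by ring.
  by rewrite normrN normrM [`|1 - _|]ger0_norm ?subr_ge0 // ler_piMl ?subr_ge0.
have Fc1 x : `|ratr (F x)| <= 1 :> algC by rewrite ratr_norm -[1](rmorph1 ratr) ler_rat.
have h1 : `|Y - \avg_(c in C) \avg_(w in D) (ratr (F (v + w + c)) * chi w)| <= ratr (2 * e).
  rewrite -[X in `|X - _|](avg_cst _ C0); apply: avg_close => // c cC.
  apply: le_trans (ler_distD (\avg_(w in D) (ratr (F (v + (w + c))) * chi (w + c))) _ _) _.
  rewrite mulr_natl mulr2n rmorphD; apply: lerD.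
    rewrite distrC.
    apply: (ainv_avg (f := fun w => ratr (F (v + w)) * chi w) (e := ratr e) D0 _ cC).
      move=> t tC; have := DC tC.
      by rewrite -(ler_rat algC) rmorphM /= !rmorph_nat.
    by move=> w; rewrite normrM chi_norm mulr1.
  apply: avg_close => // w _; rewrite chiM mulrA addrA -[X in _ - X]mulr1 -mulrBr.
  rewrite normrM normrM chi_norm mulr1 -[leRHS]mul1r.
  by apply: ler_pM => //; rewrite chi_close.
have h2 : `|\avg_(c in C) \avg_(w in D) (ratr (F (v + w + c)) * chi w)| <= ratr (z v).
  rewrite exchange_avg ratr_avg; apply: le_trans (norm_avg _ _) _; apply: ler_avg => w _.
  by rewrite avgZr normrM chi_norm mulr1 -ratr_avg ratr_norm.
have hY : `|Y| <= ratr (2 * e) + ratr (z v).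
  apply: le_trans (lerD h1 h2).
  by apply: le_trans (ler_normD _ _); rewrite subrK.
apply: (@le_trans _ _ (`|X v - Y| + `|Y|)).
  by apply: le_trans (ler_normD _ _); rewrite subrK.
apply: le_trans (lerD XY hY) _; rewrite -!rmorphD ler_rat /=; lra.
Qed.

Let X_sqr_in v : `|X v| ^+ 2 <= ratr (z v ^+ 2 + 2 * (2 * e + (1 - o v))).
Proof.
set d := 2 * e + _.
have d0 : 0 <= d by rewrite addr_ge0 ?subr_ge0 ?mulr_ge0.
have x1 : `|X v| <= 1.
  by apply: le_trans (X_le v) _; rewrite -[1](rmorph1 ratr) ler_rat.
have [r1|r1] := leP (z v + d) 1.
  apply: (@le_trans _ _ (ratr (z v + d) ^+ 2)).
    by apply: lerXn2r (X_le_z v); rewrite nnegrE // ler0q addr_ge0.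
  rewrite -rmorphXn ler_rat /= sqrrD -addrA lerD2l.
  have : z v * d + d * d <= d.
    by rewrite -mulrDl ler_piMl.
  rewrite -mulr_natr expr2; have : 0 <= d * d by rewrite mulr_ge0.
  have : z v * d <= d by rewrite ler_piMl.
  lra.
apply: (@le_trans _ _ 1); first by rewrite exprn_ile1.
rewrite -[1](rmorph1 ratr) ler_rat.
have := sqr_ge0 (1 - z v); rewrite sqrrB; lra.
Qed.

Let X_sqr_out v : `|X v| ^+ 2 <= ratr (o v).
Proof.
have x1 : `|X v| <= 1.
  by apply: le_trans (X_le v) _; rewrite -[1](rmorph1 ratr) ler_rat.
by apply: le_trans (X_le v); rewrite expr2 ler_piMl.
Qed.

Let sum_o_in : \sum_(v in B) (1 - o v) <= e / 2 * nB.
Proof.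
have -> : \sum_(v in B) (1 - o v) = nB * \avg_(v in B) \avg_(w in D) (1 - iB (v + w)).
  rewrite mulrC /avg divfK ?gt_eqF //; apply: eq_bigr => v _.
  by rewrite -/(avg _ _) avgB avg_cst.
rewrite exchange_avg mulrC ler_wpM2r ?(ltW nB0) //; apply: avg_le => // w wD.
rewrite /avg sum_in -/nB ler_pdivrMr //; move: (lv_le wD); lra.
Qed.

Let sum_o_out : \sum_(v in ~: B) o v <= e / 2 * nB.
Proof.
rewrite /o /avg -mulr_suml exchange_big /= ler_pdivrMr //.
apply: le_trans (_ : \sum_(w in D) e / 2 * nB <= _).
  by apply: ler_sum => w wD; rewrite sum_out; move: (lv_le wD); lra.
by rewrite sumr_const -(mulr_natr (e / 2 * nB)).
Qed.

(** Up to boundary effects the twist is bounded by [z v] inside [B]; outside, its square is at most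
    [o v]. The boundary terms total [O(e)] times [#|B|]. Jensen and a translation of [v] by [w] turn
    [z v ^ 2] into averages over translates of [C]. *)
Lemma sum_sqr_twist_le :
  \sum_v `|X v| ^+ 2 <= ratr (nB * (\avg_(v in B) (\avg_(c in C) F (v + c)) ^+ 2 + 7 * e)).
Proof.
rewrite (bigID (mem B)) /=.
apply: (@le_trans _ _ (ratr (\sum_(v in B) (z v ^+ 2 + 2 * (2 * e + (1 - o v)))
   + \sum_(v in ~: B) o v))).
  rewrite rmorphD !rmorph_sum /=; apply: lerD; first by apply: ler_sum.
  by under [leRHS]eq_bigl do rewrite inE; apply: ler_sum.
rewrite ler_rat; set Y := avg B _.
have h : \sum_(v in B) z v ^+ 2 <= nB * (Y + e).
  apply: (@le_trans _ _ (nB * \avg_(v in B) \avg_(w in D) (\avg_(c in C) F (v + w + c)) ^+ 2)).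
    rewrite [leRHS]mulrC /avg divfK ?gt_eqF //; apply: ler_sum => v _.
    rewrite -/(avg _ _); apply: le_trans (avg_jensen _ _) _; apply: ler_avg => w _.
    by rewrite real_normK ?num_real.
  rewrite ler_pM2l // exchange_avg; apply: avg_le => // w wD.
  have := ainv_avg (f := fun v => (\avg_(c in C) F (v + c)) ^+ 2) B0 BD wD.
  rewrite ler_distl -/Y => /(_ _)/andP[|_ //] v.
  by rewrite normrX exprn_ile1 // norm_avg_le.
rewrite big_split /= -mulr_sumr big_split /= sumr_const -mulr_natr -/nB.
move: sum_o_in sum_o_out h (mulr_ge0 e0 (ltW nB0)); lra.
Qed.

End Relative.

(* A character is nearly constant on translates of [C], so correlation with it turns
   into a large variance of the averages of [F] over these translates. *)
Lemma fourier_increment : exists i : Iirr [set: G], forall C : {set G},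
  (0 < #|C|)%N -> ainv D C e ->
  (forall c, c \in C -> `|'chi_i c - 1| <= ratr e) ->
  unorm B D F - 10 * e <= \avg_(v in B) (\avg_(c in C) F (v + c)) ^+ 2.
Proof.
have [|i hi] := @fourier_witness G (fun x => ratr (p x)) D.
  by move=> x; rewrite Creal_Crat // Crat_rat.
exists i => C C0 DC chiC.
have := sum_sqr_twist_le C0 DC (fun x y => chiD i x y) (fun x => norm_chi i x) chiC.
set Y := avg B _.
have -> : \sum_v `|\avg_(w in D) (ratr (p (v + w)) * 'chi_i w)| ^+ 2
  = (\sum_v `|\sum_(w in D) ratr (p (v + w)) * 'chi_i w| ^+ 2) / ratr nD ^+ 2.
  rewrite mulr_suml; apply: eq_bigr => v _.
  by rewrite /avg normrM exprMn normfV exprVn /nD rmorph_nat normr_nat.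
rewrite ler_pdivrMr ?exprn_gt0 ?ltr0q // => h.
have h2 : \sum_(w in D) \sum_(w' in D) corr w w' ^+ 2 <= nB * (nB * (Y + 7 * e) * nD ^+ 2).
  rewrite -(ler_rat algC).
  have -> : ratr (\sum_(w in D) \sum_(w' in D) corr w w' ^+ 2)
    = \sum_(w in D) \sum_(w' in D) (\sum_v ratr (p (v + w)) * ratr (p (v + w'))) ^+ 2 :> algC.
    rewrite rmorph_sum; apply: eq_bigr => w _; rewrite rmorph_sum; apply: eq_bigr => w' _.
    by rewrite rmorphXn rmorph_sum; congr (_ ^+ 2); apply: eq_bigr => v _; rewrite rmorphM.
  apply: le_trans hi _; rewrite rmorphM; apply: ler_pM.
  - by apply: sumr_ge0 => v _; rewrite -rmorphXn ler0q sqr_ge0.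
  - by apply: sumr_ge0 => v _; rewrite exprn_ge0.
  - have -> : \sum_v ratr (p v) ^+ 2 = ratr (\sum_v p v ^+ 2) :> algC.
      by rewrite rmorph_sum; apply: eq_bigr => v _; rewrite rmorphXn.
    rewrite ler_rat -(sum_shift 0); apply: ler_sum => v _; rewrite addr0.
    rewrite -real_normK ?num_real // expr2 -[leRHS]mulr1 ler_pM //.
  - by rewrite rmorphM rmorphXn.
have h3 : \avg_(w in D) \avg_(w' in D) (corr w w' / nB) ^+ 2 <= Y + 7 * e.
  rewrite /avg -/nD -mulr_suml.
  have -> : \sum_(w in D) \sum_(w' in D) (corr w w' / nB) ^+ 2
    = (\sum_(w in D) \sum_(w' in D) corr w w' ^+ 2) / nB ^+ 2.
    rewrite mulr_suml; apply: eq_bigr => w _; rewrite mulr_suml; apply: eq_bigr => w' _.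
    by rewrite exprMn exprVn.
  rewrite !ler_pdivrMr ?exprn_gt0 //; apply: le_trans h2 _.
  by rewrite le_eqVlt; apply/orP; left; apply/eqP; ring.
by have := unorm_le_corr; lra.
Qed.

End FourierIncrement.

(** * Size and regularity of Bohr sets *)

Section CirclePigeonhole.

(** The cell beyond [2 * n] is for [x = 1]. The absolute value and [inord] change nothing for real
    [x] in [[-1, 1]]. *)
Definition grid_cell (n : nat) (x : algC) : 'I_(2 * n).+1 :=
  inord `|(Num.floor (x * n%:R) + n%:Z)%R|%N.

Lemma grid_cell_close n (x y : algC) : (0 < n)%N ->
  x \is Num.real -> y \is Num.real -> `|x| <= 1 -> `|y| <= 1 ->
  grid_cell n x = grid_cell n y -> `|x - y| <= n%:R^-1.
Proof.
move=> n0 xR yR x1 y1 /(congr1 val) /=.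
have n0' : 0 < n%:R :> algC by rewrite ltr0n.
have bnd (z : algC) : z \is Num.real -> `|z| <= 1 ->
    (- n%:Z <= Num.floor (z * n%:R) <= n%:Z).
  move=> zR; rewrite real_ler_norml // => /andP[h1 h2]; apply/andP; split.
    rewrite real_floor_ge_int ?rpredM ?realn //.
    by rewrite mulrNz -mulN1r ler_wpM2r // ltW.
  have h : z * n%:R <= n%:R by rewrite ler_piMl // ltW.
  rewrite -(ler_int algC) -[X in _ <= X]pmulrn; apply: le_trans (real_floor_le _) h.
  by rewrite rpredM ?realn.
have := bnd x xR x1; have := bnd y yR y1.
set a := Num.floor _; set b := Num.floor _ => /andP[a1 a2] /andP[b1 b2].
rewrite !inordK; [|lia|lia].
move=> ab; have {}ab : a = b by lia.
have := real_floor_itv (_ : x * n%:R \is Num.real).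
have := real_floor_itv (_ : y * n%:R \is Num.real).
rewrite !rpredM ?realn // -/a -/b -ab => /(_ isT) /andP[u1 u2] /(_ isT) /andP[v1 v2].
rewrite -[leRHS]mul1r ler_pdivlMr // -[X in _ * X]ger0_norm ?(ltW n0') // -normrM mulrBl.
rewrite real_ler_norml ?rpredB ?rpredM ?realn //; apply/andP; split.
  rewrite lerBrDr addrC -lerBrDr opprK; apply: le_trans (ltW u2) _.
  by rewrite intrD lerD2r.
rewrite lerBlDr addrC; apply: le_trans (ltW v2) _.
by rewrite intrD lerD2r.
Qed.

Lemma pigeonhole (T U : finType) (X : {set T}) (f : T -> U) : U ->
  exists u, (#|X| <= #|U| * #|[set x in X | f x == u]|)%N.
Proof.
move=> u0; pose N u := #|[set x in X | f x == u]|.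
have [u _ umax] := @arg_maxnP _ u0 predT N isT; exists u.
have -> : #|X| = (\sum_u N u)%N.
  rewrite -sum1_card (partition_big f predT) //=; apply: eq_bigr => v _.
  by rewrite /N -sum1_card; apply: eq_bigl => x; rewrite inE.
by rewrite -sum_nat_const; apply: leq_sum => v _; apply: umax.
Qed.

End CirclePigeonhole.

Section Bohr.
Variable G : finZmodType.
Implicit Types (S : seq (Iirr [set: G])) (r : rat).

Definition bohr S r : {set G} := [set x | all (fun i => `|'chi_i x - 1| <= ratr r) S].

Lemma bohrP S r x : reflect (forall i, i \in S -> `|'chi_i x - 1| <= ratr r) (x \in bohr S r).
Proof. by rewrite inE; apply: allP. Qed.

Lemma bohr0 S r : 0 <= r -> 0 \in bohr S r.
Proof. by move=> r0; apply/bohrP => i _; rewrite chi0 subrr normr0 ler0q. Qed.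

Lemma bohr_card_gt0 S r : 0 <= r -> (0 < #|bohr S r|)%N.
Proof. by move=> r0; apply/card_gt0P; exists 0; apply: bohr0. Qed.

Lemma bohrN S r x : x \in bohr S r -> - x \in bohr S r.
Proof.
move=> /bohrP h; apply/bohrP => i /h.
by rewrite chiN -(norm_conjC ('chi_i x - 1)) rmorphB rmorph1.
Qed.

Lemma bohrD S r r' x y : x \in bohr S r -> y \in bohr S r' -> x + y \in bohr S (r + r').
Proof.
move=> /bohrP hx /bohrP hy; apply/bohrP => i iS.
have -> : 'chi_i (x + y) - 1 = 'chi_i x - 1 + 'chi_i x * ('chi_i y - 1).
  by rewrite chiD; ring.
rewrite rmorphD; apply: le_trans (ler_normD _ _) _.
by rewrite normrM norm_chi mul1r; apply: lerD; [apply: hx | apply: hy].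
Qed.

Lemma bohrS S S' r r' : {subset S <= S'} -> r' <= r -> bohr S' r' \subset bohr S r.
Proof.
move=> SS' rr'; apply/subsetP => x /bohrP h; apply/bohrP => i /SS' /h h'.
by apply: le_trans h' _; rewrite ler_rat.
Qed.

(** Real and imaginary parts are sorted separately, whence two cells per character and the distance
    [2 / n]. *)
Lemma chi_cluster S n : (0 < n)%N -> exists X : {set G},
  (#|G| <= (2 * n).+1 ^ (2 * size S) * #|X|)%N /\
  forall x y, x \in X -> y \in X -> forall i, i \in S ->
    `|'chi_i x - 'chi_i y| <= 2 / n%:R.
Proof.
move=> n0; elim: S => [|i S [X [Xcard Xclose]]].
  by exists [set: G]; rewrite cardsT mul1n.
pose f x := (grid_cell n ('Re ('chi_i x)), grid_cell n ('Im ('chi_i x))).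
have [u hu] := pigeonhole X f (ord0, ord0).
exists [set x in X | f x == u]; split.
  apply: leq_trans Xcard _; rewrite /= mulnS expnD -mulnA mulnCA leq_mul2l.
  apply/orP; right; apply: leq_trans hu _.
  by rewrite card_prod !card_ord mulnn.
move=> x y; rewrite !inE => /andP[xX /eqP fx] /andP[yX /eqP fy] k.
rewrite inE => /orP[/eqP ->|kS]; last exact: Xclose.
have im1 z : `|z| = 1 -> `|'Im z| <= 1 :> algC.
  move=> z1; rewrite -(@ler_pXn2r _ 2) ?nnegrE // expr1n real_normK ?Creal_Im //.
  rewrite -[leRHS](expr1n _ 2) -z1 normC2_Re_Im lerDr.
  by rewrite real_exprn_even_ge0 ?Creal_Re.
have re1 z : `|z| = 1 -> `|'Re z| <= 1 :> algC.
  by move=> z1; rewrite -z1; case: (leif_normC_Re_Creal z).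
move: (fx); rewrite -fy => -[/grid_cell_close hre /grid_cell_close him].
have {}hre : `|'Re ('chi_i x) - 'Re ('chi_i y)| <= n%:R^-1.
  by apply: hre; rewrite ?Creal_Re ?re1 ?norm_chi.
have {}him : `|'Im ('chi_i x) - 'Im ('chi_i y)| <= n%:R^-1.
  by apply: him; rewrite ?Creal_Im ?im1 ?norm_chi.
rewrite [X in X - _]Crect [X in _ - X]Crect.
have -> : forall a b c d : algC, a + 'i * b - (c + 'i * d) = (a - c) + 'i * (b - d).
  by move=> *; ring.
apply: le_trans (ler_normD _ _) _; rewrite normrM normCi mul1r.
by apply: le_trans (lerD hre him) _; rewrite mulr_natl mulr2n.
Qed.

(** Subtracting one fixed element maps a cluster into the Bohr set. *)
Lemma bohr_card S n : (0 < n)%N ->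
  (#|G| <= (2 * n).+1 ^ (2 * size S) * #|bohr S (2 / n%:R)|)%N.
Proof.
move=> n0; have [X [Xcard Xclose]] := chi_cluster S n0.
apply: leq_trans Xcard _; rewrite leq_mul2l; apply/orP; right.
have [->|[x0 x0X]] := set_0Vmem X; first by rewrite cards0.
rewrite -(card_imset (mem X) (addIr (- x0))); apply: subset_leq_card.
apply/subsetP => _ /imsetP[x xX ->]; apply/bohrP => i iS.
have -> : 'chi_i (x - x0) - 1 = ('chi_i x - 'chi_i x0) * 'chi_i (- x0).
  by rewrite chiD mulrBl -[X in _ = _ - X]chiD subrr chi0.
rewrite normrM norm_chi mulr1; apply: le_trans (Xclose _ _ xX x0X i iS) _.
by rewrite rmorphM /= fmorphV !rmorph_nat.
Qed.

(* Otherwise the size of the Bohr set would grow by a factor [1 + e] in each of [J]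
   steps between the radii [rho] and [2 rho]. *)
Lemma bohr_regular S (rho e : rat) (J : nat) : 0 < rho -> (0 < J)%N -> 0 <= e ->
  #|G|%:R < (1 + e) ^+ J * #|bohr S rho|%:R ->
  exists2 r, rho <= r <= 2 * rho & ainv (bohr S r) (bohr S (rho / J%:R)) (2 * e).
Proof.
move=> rho0 J0 e0 big; have J0' : 0 < J%:R :> rat by rewrite ltr0n.
pose r j : rat := rho + j%:R * (rho / J%:R).
have step0 : 0 <= rho / J%:R by rewrite divr_ge0 // ltW.
suff [j jJ hj] : exists2 j, (j < J)%N &
    #|bohr S (r j.+1)|%:R <= (1 + e) * #|bohr S (r j)|%:R :> rat.
  exists (r j).
    have h : j%:R * (rho / J%:R) <= rho.
      by rewrite mulrCA ler_piMr ?(ltW rho0) // ler_pdivrMr // mul1r ler_nat ltnW.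
    have h0 : 0 <= j%:R * (rho / J%:R) by rewrite mulr_ge0.
    by rewrite /r; apply/andP; split; lra.
  move=> t tT; rewrite natrM -mulrA ler_pM2l ?ltr0n //.
  apply: (@le_trans _ _ (#|bohr S (r j.+1) :\: bohr S (r j)|%:R)).
    rewrite ler_nat -(card_imset (mem (leavers _ _)) (addIr t)); apply: subset_leq_card.
    apply/subsetP => _ /imsetP[x /setIdP[xB xtB] ->].
    rewrite in_setD xtB; have := bohrD xB tT.
    suff -> : r j + rho / J%:R = r j.+1 by [].
    by rewrite /r -addrA -[in RHS]natr1 mulrDl mul1r.
  have sub : bohr S (r j) \subset bohr S (r j.+1).
    by apply: bohrS => //; rewrite /r lerD2l ler_wpM2r // ler_nat.
  rewrite cardsD (setIidPr sub) natrB ?subset_leq_card // lerBlDr.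
  by apply: le_trans hj _; rewrite mulrDl mul1r addrC.
apply: contrapT => no; have {}no j : (j < J)%N ->
    (1 + e) * #|bohr S (r j)|%:R < #|bohr S (r j.+1)|%:R :> rat.
  by move=> jJ; rewrite ltNge; apply/negP => h; apply: no; exists j.
have grow j : (j <= J)%N -> (1 + e) ^+ j * #|bohr S rho|%:R <= #|bohr S (r j)|%:R :> rat.
  elim: j => [_|j IH jJ]; first by rewrite expr0 mul1r /r mul0r addr0.
  rewrite exprS -mulrA; apply: le_trans (ltW (no _ jJ)).
  by rewrite ler_wpM2l ?addr_ge0 // IH // ltnW.
have := lt_le_trans big (grow J (leqnn J)).
by rewrite ltr_nat ltnNge max_card.
Qed.

End Bohr.

(** * Triples of regular Bohr sets at decreasing scales *)

Section Cells.
Variables (G : finZmodType) (e : rat) (l j K : nat).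
Implicit Types (S : seq (Iirr [set: G])) (B C D : {set G}).

Definition radius t : rat := 2^-1 ^+ (l + j.+1 * t).

(** Bounds the index of every Bohr set that occurs: scales up to [3 * K + 2], at most [2 * K]
    characters, two grid coordinates for each. *)
Definition size_bound : nat := (2 ^ (l + j.+1 * (3 * K + 2) + 3)) ^ (4 * K).

Hypothesis e0 : 0 < e.
Hypothesis radius_e : 2 * radius 0 <= e.
Hypothesis bound_lt : size_bound%:R < (1 + e / 2) ^+ (2 ^ j).
Hypothesis bound_G : size_bound%:R <= e * #|G|%:R.

(* The ratio [2 ^ j.+1] of consecutive radii leaves room for the [2 ^ j] steps of
   [bohr_regular]; [t] indexes the radius scale. *)
Definition regular_bohr (S : seq (Iirr [set: G])) t (B : {set G}) : Prop :=
  exists r, [/\ radius t <= r <= 2 * radius t, B = bohr S r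
              & ainv B (bohr S (2 * radius t.+1)) e].

(** Each refinement consumes three scales and adds two frequencies, one for each of the two test
    functions. The increment argument uses cells only through [cellP] and [cell_refine]. *)
Definition cell k (B C D : {set G}) : Prop := exists S, [/\ (size S <= 2 * k)%N,
  regular_bohr S (3 * k) B, regular_bohr S (3 * k + 1) C & regular_bohr S (3 * k + 2) D].

Lemma radius_gt0 t : 0 < radius t. Proof. by rewrite exprn_gt0. Qed.

Lemma radiusS t : 2 * radius t.+1 = radius t / (2 ^ j)%:R.
Proof.
rewrite /radius mulnS addnCA exprD exprS natrX -exprVn; field.
by [].

Qed.

Lemma radiusS_le t : 2 * radius t.+1 <= radius t.
Proof.
rewrite radiusS ler_pdivrMr ?ltr0n ?expn_gt0 // ler_peMr ?(ltW (radius_gt0 t)) //.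
by rewrite ler1n expn_gt0.
Qed.

Lemma radius_le t t' : (t <= t')%N -> radius t' <= radius t.
Proof.
move=> tt'; apply: ler_wiXn2l; rewrite ?invr_ge0 ?invf_le1 ?ler1n //.
by rewrite leq_add2l leq_mul2l tt' orbT.
Qed.

Lemma bohr_radius_card S t : (size S <= 2 * K)%N -> (t <= 3 * K + 2)%N ->
  (#|G| <= size_bound * #|bohr S (radius t)|)%N.
Proof.
move=> hS ht; set m := (l + j.+1 * t)%N.
have := @bohr_card G S (2 ^ m.+1) (expn_gt0 2 m.+1).
have -> : 2 / (2 ^ m.+1)%:R = radius t.
  rewrite /radius -/m natrX exprS invfM mulrA divff ?pnatr_eq0 // mul1r exprVn //.
move=> h; apply: leq_trans h _; rewrite leq_mul2r; apply/orP; right.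
rewrite /size_bound.
have h1 : ((2 * 2 ^ m.+1).+1 <= 2 ^ (m + 3))%N.
  rewrite expnD expnS; have := expn_gt0 2 m; set q := (2 ^ m)%N => /=; lia.
have h2 : (2 ^ (m + 3) <= 2 ^ (l + j.+1 * (3 * K + 2) + 3))%N.
  by rewrite leq_exp2l // leq_add2r leq_add2l leq_mul2l ht orbT.
have [->|s0] := posnP (size S); first by rewrite muln0 expn0 !expn_gt0.
apply: leq_trans (_ : (2 ^ (l + j.+1 * (3 * K + 2) + 3)) ^ (2 * size S) <= _)%N.
  have s1 : (0 < 2 * size S)%N by lia.
  by rewrite (leq_exp2r _ _ s1); apply: leq_trans h1 h2.
by apply: leq_pexp2l; [rewrite expn_gt0 | lia].
Qed.

Lemma regular_bohr_exists S t : (size S <= 2 * K)%N -> (t <= 3 * K + 2)%N ->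
  exists B, regular_bohr S t B.
Proof.
move=> hS ht.
have [] := @bohr_regular G S (radius t) (e / 2) (2 ^ j) (radius_gt0 t).
- by rewrite expn_gt0.
- by rewrite divr_ge0 // ltW.
- apply: le_lt_trans (_ : size_bound%:R * #|bohr S (radius t)|%:R < _).
    by rewrite -natrM ler_nat bohr_radius_card.
  by rewrite ltr_pM2r // ltr0n bohr_card_gt0 // ltW // radius_gt0.
move=> r hr inv; exists (bohr S r), r; split=> //.
by rewrite radiusS; have -> : e = 2 * (e / 2) by field.
Qed.

Lemma regular_bohrP S t B : (size S <= 2 * K)%N -> (t <= 3 * K + 2)%N ->
  regular_bohr S t B ->
  [/\ (0 < #|B|)%N, forall x, x \in B -> - x \in B & 1 <= e * #|B|%:R].
Proof.
move=> hS ht [r [/andP[r1 r2] -> _]]; have r0 := le_trans (ltW (radius_gt0 t)) r1.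
split; [exact: bohr_card_gt0 | by move=> x; apply: bohrN |].
have P0 : 0 < size_bound%:R :> rat by rewrite ltr0n expn_gt0 expn_gt0.
rewrite -(ler_pM2l P0) mulr1; apply: le_trans bound_G _.
rewrite mulrCA ler_pM2l // -natrM ler_nat; apply: leq_trans (bohr_radius_card hS ht) _.
by rewrite leq_mul2l subset_leq_card ?orbT // bohrS.
Qed.

Lemma ainv_regular_bohr S S' t t' B B' : {subset S <= S'} -> (t < t')%N ->
  regular_bohr S t B -> regular_bohr S' t' B' -> ainv B B' e.
Proof.
move=> SS' tt' [r [_ _ inv]] [r' [/andP[_ h] -> _]]; apply: ainvS inv.
by apply: bohrS => //; apply: le_trans h _; rewrite ler_pM2l ?radius_le.
Qed.

Lemma cellP k B C D : (k <= K)%N -> cell k B C D ->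
  [/\ [/\ (0 < #|B|)%N, (0 < #|C|)%N & (0 < #|D|)%N],
      [/\ ainv B C e, ainv B D e & ainv C D e],
      forall x, x \in C -> - x \in C & 1 <= e * #|C|%:R].
Proof.
move=> kK [S [hS hB hC hD]].
have hS' : (size S <= 2 * K)%N by apply: leq_trans hS _; rewrite leq_mul2l kK orbT.
have t0 : (3 * k <= 3 * K + 2)%N by lia.
have t1 : (3 * k + 1 <= 3 * K + 2)%N by lia.
have t2 : (3 * k + 2 <= 3 * K + 2)%N by lia.
have [B0 _ _] := regular_bohrP hS' t0 hB.
have [C0 CN Ce] := regular_bohrP hS' t1 hC.
have [D0 _ _] := regular_bohrP hS' t2 hD.
split.
- by [].
- split; [apply: ainv_regular_bohr hB hC | apply: ainv_regular_bohr hB hD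
         | apply: ainv_regular_bohr hC hD] => //; lia.
- by [].
- by [].
Qed.

Lemma cell_exists S k : (k <= K)%N -> (size S <= 2 * k)%N ->
  exists B C D, [/\ cell k B C D, regular_bohr S (3 * k) B & regular_bohr S (3 * k + 1) C].
Proof.
move=> kK hS.
have hS' : (size S <= 2 * K)%N by apply: leq_trans hS _; rewrite leq_mul2l kK orbT.
have t0 : (3 * k <= 3 * K + 2)%N by lia.
have t1 : (3 * k + 1 <= 3 * K + 2)%N by lia.
have t2 : (3 * k + 2 <= 3 * K + 2)%N by lia.
have [B hB] := regular_bohr_exists hS' t0.
have [C hC] := regular_bohr_exists hS' t1.
have [D hD] := regular_bohr_exists hS' t2.
by exists B, C, D; split=> //; exists S.
Qed.

(** The frequencies found for [F] and [H] join the same set [S'], so one new triple serves both: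
    [B'] makes the first character nearly constant, [C'] the second. *)
Lemma cell_refine k B C D (F H : G -> rat) : (k < K)%N -> cell k B C D ->
  (forall x, `|F x| <= 1) -> (forall x, `|H x| <= 1) ->
  exists B' C' D', [/\ cell k.+1 B' C' D', ainv C B' e, ainv C C' e,
    unorm C D F - 10 * e <= \avg_(y in C) (\avg_(x in B') F (y + x)) ^+ 2 &
    unorm C D H - 10 * e <= \avg_(y in C) (\avg_(x in C') H (y + x)) ^+ 2].
Proof.
move=> kK cellk F1 H1; have [[B0 C0 D0] [BC BD CD] CN Ce] := cellP (ltnW kK) cellk.
have [i hi] := fourier_increment C0 D0 (ltW e0) CD F1.
have [i' hi'] := fourier_increment C0 D0 (ltW e0) CD H1.
case: cellk => S [hS hB hC hD]; pose S' := [:: i, i' & S].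
have SS' : {subset S <= S'} by move=> x xS; rewrite !inE xS !orbT.
have [|B' [C' [D' [cell' hB' hC']]]] := @cell_exists S' k.+1 kK.
  by rewrite /= mulnS; lia.
have chi_small t (E : {set G}) (m : Iirr [set: G]) : regular_bohr S' t.+1 E -> m \in S' ->
    forall c, c \in E -> `|'chi_m c - 1| <= ratr e.
  move=> [r [/andP[_ r2] -> _]] mS' c /bohrP/(_ m mS') h; apply: le_trans h _.
  rewrite ler_rat; apply: le_trans r2 _; apply: le_trans (radiusS_le t) _.
  apply: le_trans (radius_le (leq0n t)) _; apply: le_trans radius_e.
  by rewrite ler_peMl // ltW // radius_gt0.
have S'K : (size S' <= 2 * K)%N by rewrite /= ; lia.
have [|B'0 _ _] := regular_bohrP S'K _ hB'; first by lia.
have [|C'0 _ _] := regular_bohrP S'K _ hC'; first by lia.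
exists B', C', D'; split=> //.
- by apply: ainv_regular_bohr hC hB' => //; lia.
- by apply: ainv_regular_bohr hC hC' => //; lia.
- apply: hi => //.
    by apply: ainv_regular_bohr hD hB' => //; lia.
  have e1 : (3 * k.+1 = (3 * k + 2).+1)%N by lia.
  by rewrite e1 in hB'; apply: chi_small hB' _; rewrite inE eqxx.
- apply: hi' => //.
    by apply: ainv_regular_bohr hD hC' => //; lia.
  have e1 : (3 * k.+1 + 1 = (3 * k + 3).+1)%N by lia.
  by rewrite e1 in hC'; apply: chi_small hC' _; rewrite !inE eqxx orbT.
Qed.

End Cells.

(** * The density increment *)

Lemma quarter_le (R : realFieldType) (p x e : R) :
  8 * e <= p -> p / 2 <= x -> p / 4 <= x - 2 * e.
Proof. by move=> h1 h2; lra. Qed.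

Section Increment.
Variables (R : realFieldType) (G : finZmodType) (e : R) (K : nat).
Variable cell : nat -> {set G} -> {set G} -> {set G} -> Prop.
Hypothesis e0 : 0 < e.
Hypothesis cellP : forall k B C D, (k <= K)%N -> cell k B C D ->
  [/\ [/\ (0 < #|B|)%N, (0 < #|C|)%N & (0 < #|D|)%N],
      [/\ ainv B C e, ainv B D e & ainv C D e],
      forall x, x \in C -> - x \in C & 1 <= e * #|C|%:R].
Hypothesis cell_refine : forall k B C D (F H : G -> R), (k < K)%N -> cell k B C D ->
  (forall x, `|F x| <= 1) -> (forall x, `|H x| <= 1) ->
  exists B' C' D', [/\ cell k.+1 B' C' D', ainv C B' e, ainv C C' e,
    unorm C D F - 10 * e <= \avg_(y in C) (\avg_(x in B') F (y + x)) ^+ 2 &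
    unorm C D H - 10 * e <= \avg_(y in C) (\avg_(x in C') H (y + x)) ^+ 2].
Implicit Types (B C D : {set G}) (a b : G).

Section Energy.
Variables (e1 e2 : pred G) (A : G -> G -> bool) (th ta : R).
Hypothesis A_sub : forall x y, A x y -> e1 x && e2 y.
Hypotheses (th0 : 0 <= th) (th1 : th <= 1) (ta0 : 0 <= ta) (ta1 : ta <= 1).

Definition dens (f : pred G) B a : R := \avg_(x in B) (f (a + x))%:R.

Definition excess a b B C : R :=
  \avg_(x in B) \avg_(y in C) ((A (a + x) (b + y))%:R - th * ((e1 (a + x)) && (e2 (b + y)))%:R).

(** Only the squares gain, by a variance; the excess is an average, preserved in mean up to [O(e)]
    on passing to narrower translates. *)
Definition potential a b B C : R :=
  excess a b B C + ta * (dens e1 B a ^+ 2 + dens e2 C b ^+ 2).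

(** Deviations from the density on [B] are tested on the translates [z + C], as
    [corner_free_increment] requires. *)
Definition nonunif1 a B C D : R :=
  \avg_(z in B) unorm C D (fun x => (e1 (a + (z + x)))%:R - dens e1 B a).
Definition nonunif2 b C D : R :=
  unorm C D (fun y => (e2 (b + y))%:R - dens e2 C b).

Let om x y : R := (A x y)%:R - th * (e1 x && e2 y)%:R.

Lemma norm_excess_le1 x y : `|om x y| <= 1.
Proof.
rewrite /om; have := @A_sub x y; case: (A x y) => [->//|_].
  by rewrite mulr1 ger0_norm ?subr_ge0 // gerBl.
rewrite sub0r normrN; case: (_ && _); rewrite ?mulr0 ?normr0 ?mulr1 //.
by rewrite ger0_norm.
Qed.

Lemma norm_natb_sub (x : bool) (b : R) : 0 <= b -> b <= 1 -> `|x%:R - b| <= 1.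
Proof.
case: x => b0 b1; first by rewrite ger0_norm ?subr_ge0 // gerBl.
by rewrite sub0r normrN ger0_norm.
Qed.

Lemma dens_ge0 (f : pred G) B a : 0 <= dens f B a.
Proof. by apply: avg_ge0 => x _; case: (f _). Qed.

Lemma dens_le1 (f : pred G) B a : (0 < #|B|)%N -> dens f B a <= 1.
Proof. by move=> B0; apply: avg_le => // x _; case: (f _). Qed.

Lemma avg_excess_close a b C B' C' : (0 < #|C|)%N -> (0 < #|B'|)%N -> (0 < #|C'|)%N ->
  ainv C B' e -> ainv C C' e ->
  \avg_(y in C) \avg_(y' in C) om (a + y) (b + y') - 2 * e
    <= \avg_(y in C) \avg_(y' in C) \avg_(x in B') \avg_(x' in C')
          om (a + y + x) (b + y' + x').
Proof.
move=> C0 B'0 C'0 CB CC'.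
have -> : \avg_(y in C) \avg_(y' in C) \avg_(x in B') \avg_(x' in C')
          om (a + y + x) (b + y' + x')
  = \avg_(x in B') \avg_(x' in C') \avg_(y in C) \avg_(y' in C)
      om (a + (y + x)) (b + (y' + x')).
  transitivity (\avg_(y in C) \avg_(x in B') \avg_(y' in C) \avg_(x' in C')
          om (a + y + x) (b + y' + x')).
    by apply: eq_avg => y _; rewrite exchange_avg.
  rewrite exchange_avg; apply: eq_avg => x _.
  transitivity (\avg_(y in C) \avg_(x' in C') \avg_(y' in C)
          om (a + y + x) (b + y' + x')).
    by apply: eq_avg => y _; rewrite exchange_avg.
  rewrite exchange_avg; apply: eq_avg => x' _; apply: eq_avg => y _.
  by apply: eq_avg => y' _; rewrite !addrA.
set W := \avg_(y in C) _.
suff : `|\avg_(x in B') \avg_(x' in C') \avg_(y in C) \avg_(y' in C)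
      om (a + (y + x)) (b + (y' + x')) - W| <= 2 * e by rewrite ler_norml; lra.
rewrite -[X in `|_ - X|](avg_cst _ B'0); apply: avg_close => // x xB.
rewrite -[X in `|_ - X|](avg_cst _ C'0); apply: avg_close => // x' xC.
have -> : 2 * e = e + e by ring.
apply: le_trans (ler_distD (\avg_(y in C) \avg_(y' in C) om (a + y) (b + (y' + x'))) _ _) _.
apply: lerD.
  apply: (ainv_avg (f := fun y => \avg_(y' in C) om (a + y) (b + (y' + x'))) C0 CB xB).
  by move=> y; apply: norm_avg_le => // y' _; apply: norm_excess_le1.
apply: avg_close => // y _.
apply: (ainv_avg (f := fun y' => om (a + y) (b + y')) C0 CC' xC) => y'.
exact: norm_excess_le1.
Qed.

(** [be] need not be the density on [a + C], so the linear term stays; in [potential_step] it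
    averages out over [z]. *)
Lemma avg_dens_sqr_ge (f : pred G) a (be u : R) C B' : (0 < #|C|)%N -> (0 < #|B'|)%N ->
  ainv C B' e -> 0 <= be -> be <= 1 ->
  u <= \avg_(y in C) (\avg_(x in B') ((f (a + (y + x)))%:R - be)) ^+ 2 ->
  be ^+ 2 + 2 * be * (\avg_(y in C) ((f (a + y))%:R - be)) - 2 * e + u
    <= \avg_(y in C) dens f B' (a + y) ^+ 2.
Proof.
move=> C0 B'0 CB be0 be1 hu; pose F x : R := (f (a + x))%:R - be.
have F1 x : `|F x| <= 1 by apply: norm_natb_sub.
have -> : \avg_(y in C) dens f B' (a + y) ^+ 2
  = be ^+ 2 + 2 * be * (\avg_(y in C) \avg_(x in B') F (y + x))
    + \avg_(y in C) (\avg_(x in B') F (y + x)) ^+ 2.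
  rewrite -(avg_cst (be ^+ 2) C0) -avgZ -!avgD; apply: eq_avg => y _.
  have -> : dens f B' (a + y) = be + \avg_(x in B') F (y + x).
    rewrite -[X in _ = X + _](avg_cst _ B'0) -avgD; apply: eq_avg => x _.
    by rewrite /F -(addrA a) [RHS]addrC subrK.
  by ring.
have h : `|\avg_(y in C) \avg_(x in B') F (y + x) - \avg_(y in C) F y| <= e.
  rewrite exchange_avg -[X in `|_ - X|](avg_cst _ B'0); apply: avg_close => // x xB.
  exact: (ainv_avg C0 CB xB).
have h2 : be * (\avg_(y in C) F y - e) <= be * \avg_(y in C) \avg_(x in B') F (y + x).
  by rewrite ler_wpM2l //; move: h; rewrite ler_norml; lra.
have h3 : be * e <= e by rewrite ler_piMl // ltW.
move: hu h2 h3; rewrite -/(F _) /F; lra.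
Qed.

(* The new frequency for [e1] depends on the translate [z], so [z] is chosen first,
   maximizing the expected gain, and the translate of [C] afterwards. *)
Lemma potential_step a b k B C D : (k < K)%N -> cell k B C D ->
  exists a' b' B' C' D', cell k.+1 B' C' D' /\
    potential a b B C + ta * (nonunif1 a B C D + nonunif2 b C D) - 30 * e
      <= potential a' b' B' C'.
Proof.
move=> kK cellk; have [[B0 C0 D0] [BC BD CD] CN Ce] := cellP (ltnW kK) cellk.
pose be1 := dens e1 B a; pose be2 := dens e2 C b.
pose F x : R := (e1 (a + x))%:R - be1; pose H y : R := (e2 (b + y))%:R - be2.
have F1 x : `|F x| <= 1 by apply: norm_natb_sub; rewrite ?dens_ge0 ?dens_le1.
have H1 x : `|H x| <= 1 by apply: norm_natb_sub; rewrite ?dens_ge0 ?dens_le1.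
have be1_ge0 : 0 <= be1 by apply: dens_ge0.
have be1_le1 : be1 <= 1 by apply: dens_le1.
have be2_ge0 : 0 <= be2 by apply: dens_ge0.
have be2_le1 : be2 <= 1 by apply: dens_le1.
(* [Psi] collects the part of the expected new potential that depends on [z]. *)
pose Psi z := \avg_(y in C) \avg_(y' in C) om (a + z + y) (b + y')
  + ta * (2 * be1 * (\avg_(y in C) F (z + y)) + unorm C D (fun x => F (z + x))).
have [z zB hz] := avg_exists Psi B0.
have hPsi : excess a b B C + ta * nonunif1 a B C D - 3 * e <= \avg_(z in B) Psi z.
  have -> : \avg_(z in B) Psi z
    = \avg_(z in B) \avg_(y in C) \avg_(y' in C) om (a + z + y) (b + y')
    + ta * (2 * be1 * (\avg_(z in B) \avg_(y in C) F (z + y)) + nonunif1 a B C D).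
    by rewrite avgD avgZ avgD avgZ.
  have h1 : `|\avg_(z in B) \avg_(y in C) \avg_(y' in C) om (a + z + y) (b + y')
      - excess a b B C| <= e.
    rewrite exchange_avg -[X in `|_ - X|](avg_cst _ C0); apply: avg_close => // y yC.
    have -> : \avg_(x in B) \avg_(y' in C) om (a + x + y) (b + y')
      = \avg_(x in B) \avg_(y' in C) om (a + (x + y)) (b + y').
      by apply: eq_avg => x _; rewrite addrA.
    apply: (ainv_avg (f := fun x => \avg_(y' in C) om (a + x) (b + y')) B0 BC yC) => x.
    by apply: norm_avg_le => // y' _; apply: norm_excess_le1.
  have h2 : `|\avg_(z in B) \avg_(y in C) F (z + y)| <= e.
    have F0 : \avg_(z in B) F z = 0 by rewrite avgB avg_cst // subrr.
    rewrite -[X in `|X|]subr0 -F0 exchange_avg -[X in `|_ - X|](avg_cst _ C0).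
    by apply: avg_close => // y yC; apply: (ainv_avg B0 BC yC).
  have h3 : `|ta * (be1 * \avg_(z in B) \avg_(y in C) F (z + y))| <= e.
    rewrite normrM (ger0_norm ta0) normrM (ger0_norm be1_ge0) mulrA; apply: le_trans h2.
    by rewrite ler_piMl // mulr_ile1.
  move: h1 h3; rewrite !ler_norml; lra.
have [B' [C' [D' [cell' CB' CC' hF hH]]]] :=
  cell_refine kK cellk (fun x => F1 (z + x)) H1.
have [[B'0 C'0 D'0] _ _ _] := cellP kK cell'.
have cW := avg_excess_close (a + z) b C0 B'0 C'0 CB' CC'.
have c1 : be1 ^+ 2 + 2 * be1 * (\avg_(y in C) F (z + y)) - 2 * e
     + (unorm C D (fun x => F (z + x)) - 10 * e)
    <= \avg_(y in C) dens e1 B' (a + z + y) ^+ 2.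
  have := @avg_dens_sqr_ge e1 (a + z) be1 (unorm C D (fun x => F (z + x)) - 10 * e) C B'
    C0 B'0 CB' be1_ge0 be1_le1.
  have -> : \avg_(y in C) ((e1 (a + z + y))%:R - be1) = \avg_(y in C) F (z + y).
    by apply: eq_avg => y _; rewrite /F addrA.
  apply; apply: le_trans hF _; apply: ler_avg => y _.
  rewrite le_eqVlt; apply/orP; left; apply/eqP; congr (_ ^+ 2).
  by apply: eq_avg => x _; rewrite /F -!addrA.
have c2 : be2 ^+ 2 + 2 * be2 * (\avg_(y in C) H y) - 2 * e
     + (unorm C D H - 10 * e) <= \avg_(y in C) dens e2 C' (b + y) ^+ 2.
  exact: avg_dens_sqr_ge.
have H0 : \avg_(y in C) H y = 0 by rewrite avgB avg_cst // subrr.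
have [y yC hy] := avg_exists (fun y => \avg_(y' in C) potential (a + z + y) (b + y') B' C') C0.
have [y' y'C hy'] := avg_exists (fun y' => potential (a + z + y) (b + y') B' C') C0.
exists (a + z + y), (b + y'), B', C', D'; split=> //.
apply: le_trans hy'; apply: le_trans hy.
have -> : \avg_(y in C) \avg_(y' in C) potential (a + z + y) (b + y') B' C'
  = \avg_(y in C) \avg_(y' in C) \avg_(x in B') \avg_(x' in C') om (a + z + y + x) (b + y' + x')
  + ta * (\avg_(y in C) dens e1 B' (a + z + y) ^+ 2 + \avg_(y in C) dens e2 C' (b + y) ^+ 2).
  rewrite -[X in _ + ta * (_ + X)](avg_cst _ C0) -avgD -avgZ -avgD; apply: eq_avg => t _.
  rewrite -[X in ta * (X + _)](avg_cst _ C0) -avgD -avgZ -avgD; apply: eq_avg => t' _.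
  by [].
have c1' := ler_wpM2l ta0 (lerD c1 c2).
have te : ta * e <= e by rewrite ler_piMl // ltW.
(* The losses: [3 * e] for the choice of [z], [2 * e] for the excess, and [12 * e] for each of the
   two squared densities. *)
move: hPsi; set avgPsi := avg B Psi in hz *; move: hz cW c1' te e0.
rewrite H0 /Psi /potential /nonunif2 -/be1 -/be2 -/(unorm C D H).
set u1 := nonunif1 _ _ _ _; set u2 := unorm C D H; set u3 := unorm C D _.
lra.
Qed.

Lemma nonunif1_ge0 a B C D : 0 <= nonunif1 a B C D.
Proof. by do 3!(apply: avg_ge0 => ? _); apply: sqr_ge0. Qed.

Lemma nonunif2_ge0 b C D : 0 <= nonunif2 b C D.
Proof. by do 2!(apply: avg_ge0 => ? _); apply: sqr_ge0. Qed.

Lemma potential_le3 a b B C : (0 < #|B|)%N -> (0 < #|C|)%N -> potential a b B C <= 3.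
Proof.
move=> B0 C0; have h : `|excess a b B C| <= 1.
  by apply: norm_avg_le => // x _; apply: norm_avg_le => // y _; apply: norm_excess_le1.
have sq (f : pred G) (E : {set G}) (c : G) : (0 < #|E|)%N -> dens f E c ^+ 2 <= 1.
  by move=> E0; rewrite exprn_ile1 ?dens_ge0 ?dens_le1.
have h2 : ta * (dens e1 B a ^+ 2 + dens e2 C b ^+ 2) <= 1 * (1 + 1).
  by apply: ler_pM => //; [rewrite addr_ge0 ?sqr_ge0 | apply: lerD; apply: sq].
by move: h h2; rewrite ler_norml /potential; lra.
Qed.

(** Every cell that is not uniform allows a gain of [g]. For large [n] the second alternative
    exceeds the bound of [potential_le3], so uniformity must occur. *)
Lemma potential_climb (et g : R) n a b k B C D : 0 <= et ->
  g <= ta * et - 30 * e -> (k + n <= K)%N -> cell k B C D ->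
  exists a' b' B' C' D' k', [/\ (k' <= k + n)%N, cell k' B' C' D' &
    (potential a b B C <= potential a' b' B' C' /\
     nonunif1 a' B' C' D' <= et /\ nonunif2 b' C' D' <= et) \/
    potential a b B C + n%:R * g <= potential a' b' B' C'].
Proof.
move=> et0 hg; elim: n a b k B C D => [|n IH] a b k B C D kn cellk.
  by exists a, b, B, C, D, k; split; rewrite ?addn0 ?mul0r ?addr0 //; right.
have [good|bad] := boolP ((nonunif1 a B C D <= et) && (nonunif2 b C D <= et)).
  exists a, b, B, C, D, k; split; rewrite ?leq_addr //; left.
  by case/andP: good.
have [|a' [b' [B' [C' [D' [cell' hpot]]]]]] := @potential_step a b k B C D _ cellk.
  by apply: leq_trans kn; rewrite addnS ltnS leq_addr.
have gain : potential a b B C + g <= potential a' b' B' C'.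
  apply: le_trans hpot.
  suff : ta * et <= ta * (nonunif1 a B C D + nonunif2 b C D) by move: hg; lra.
  rewrite ler_wpM2l //; have := nonunif1_ge0 a B C D; have := nonunif2_ge0 b C D.
  by move: bad; rewrite negb_and -!ltNge => /orP[]; lra.
have [|a2 [b2 [B2 [C2 [D2 [k2 [hk2 cell2 h2]]]]]]] := IH a' b' k.+1 B' C' D' _ cell'.
  by rewrite addSnnS.
(* If [g] is negative, the second alternative holds at the starting cell. *)
have [g0|g0] := leP 0 g.
  exists a2, b2, B2, C2, D2, k2; split => //; first by rewrite -addSnnS.
  case: h2 => [[h3 h4]|h3]; [left; split=> //; lra|right].
  by rewrite -natr1 mulrDl; lra.
exists a, b, B, C, D, k; split; rewrite ?leq_addr //; right.
by rewrite gerDl mulr_ge0_le0 ?ler0n // ltW.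
Qed.

End Energy.

(** * Iteration of the increment *)

Variable A : G -> G -> bool.
Hypothesis A_corner : forall x y d, A x y -> A (x + d) y -> A x (y + d) -> d = 0.

(* The bound [w] on the excess is also a lower bound for the densities of [e1], [e2]. *)
Definition stage (th w : R) k : Prop := exists a b B C D (e1 e2 : pred G),
  cell k B C D /\
  w <= excess e1 e2 (fun x y => [&& A x y, e1 x & e2 y]) th a b B C.

Lemma stage_step (th th0 ka eta s w wmin : R) n k :
  0 <= th0 -> th0 <= th -> th <= 1 -> 0 <= ka -> ka <= th0 ^+ 10 / 256 / 128 ->
  0 < wmin -> wmin <= w -> w <= 1 -> 0 <= eta -> 0 <= s ->
  s <= th0 ^+ 10 * (wmin / 2) ^+ 6 / 128 / 128 -> 3 * e + 2 * eta <= s ^+ 2 ->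
  8 * e <= ka * wmin -> 480 * e <= wmin * eta ^+ 4 -> 64 <= n%:R * (wmin * eta ^+ 4) ->
  (k + n < K)%N -> stage th w k ->
  exists2 k', (k' <= k + n.+1)%N & th + ka <= 1 /\ stage (th + ka) (ka * w / 4) k'.
Proof.
move=> th0_ge0 th0_le th_le1 ka0 ka_le wmin0 wmin_w w1 eta0 s0 s_le err_le e_ka e_eta n_big kn.
move=> [a [b [B [C [D [e1 [e2 [cellk hw]]]]]]]].
have w0 : 0 < w by apply: lt_le_trans wmin_w.
have th_ge0 : 0 <= th by apply: le_trans th0_le.
pose A1 x y := [&& A x y, e1 x & e2 y].
have A1_sub x y : A1 x y -> e1 x && e2 y by case/and3P=> _ -> ->.
(* The squared densities then contribute at most [w / 4], so a potential of at least [w] still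
   contains an excess of at least [w / 2]. *)
pose ta := w / 8.
have ta0 : 0 <= ta by rewrite divr_ge0 // ltW.
have ta1 : ta <= 1 by rewrite /ta; lra.
have et0 : 0 <= eta ^+ 4 by rewrite exprn_ge0.
have gain : wmin * eta ^+ 4 / 16 <= ta * eta ^+ 4 - 30 * e.
  have : wmin * eta ^+ 4 <= w * eta ^+ 4 by rewrite ler_wpM2r.
  by rewrite /ta; move: e_eta; lra.
have [a' [b' [B' [C' [D' [k' [kk' cell' alt]]]]]]] :=
  @potential_climb e1 e2 A1 th ta A1_sub th_ge0 th_le1 ta0 ta1 _ _ n a b k B C D et0 gain
    (ltnW kn) cellk.
have kK' : (k' < K)%N := leq_ltn_trans kk' kn.
have [[B0 C0 D0] [BC BD CD] CN Ce] := cellP (ltnW kK') cell'.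
have pot_ge : w <= potential e1 e2 A1 th ta a b B C.
  apply: le_trans hw _; rewrite /potential lerDl mulr_ge0 // addr_ge0 ?sqr_ge0 //.
have pot_le := potential_le3 A1_sub th_ge0 th_le1 ta0 ta1 a' b' B0 C0.
have [pot_mono [U1 U2]] :
     potential e1 e2 A1 th ta a b B C <= potential e1 e2 A1 th ta a' b' B' C' /\
     nonunif1 e1 a' B' C' D' <= eta ^+ 4 /\ nonunif2 e2 b' C' D' <= eta ^+ 4.
  (* A full climb gains at least [64 / 16 = 4], but the potential never exceeds 3. *)
  case: alt => // h; exfalso; move: h pot_ge pot_le w0 n_big; lra.
have sq (f : pred G) (E : {set G}) (c : G) : (0 < #|E|)%N -> dens f E c ^+ 2 <= 1.
  by move=> E0; rewrite exprn_ile1 ?dens_ge0 ?dens_le1.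
pose b1 := dens e1 B' a'; pose b2 := dens e2 C' b'.
pose al : R := \avg_(x in B') \avg_(y in C') (A1 (a' + x) (b' + y))%:R.
have exE : excess e1 e2 A1 th a' b' B' C' = al - th * (b1 * b2).
  rewrite /al /b1 /dens -avgZr -avgZ -avgB; apply: eq_avg => x _.
  rewrite /b2 /dens -avgZ -avgZ -avgB; apply: eq_avg => y _.
  by case: (e1 _); case: (e2 _); rewrite /= ?mulr1 ?mulr0 ?mul0r.
have al_ge : w / 2 + th * (b1 * b2) <= al.
  have h : ta * (b1 ^+ 2 + b2 ^+ 2) <= ta * (1 + 1).
    by rewrite ler_wpM2l // lerD ?sq.
  move: pot_mono; rewrite {2}/potential exE -/b1 -/b2; move: pot_ge w0 h; rewrite /ta; lra.
have b1_ge0 : 0 <= b1 by apply: dens_ge0.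
have b2_ge0 : 0 <= b2 by apply: dens_ge0.
have b1_le1 : b1 <= 1 by apply: dens_le1.
have b2_le1 : b2 <= 1 by apply: dens_le1.
have bb_ge0 : 0 <= b1 * b2 by rewrite mulr_ge0.
have al_w : w / 2 <= al.
  by apply: le_trans al_ge; rewrite lerDl mulr_ge0.
have al_le : al <= b1 * b2.
  rewrite /al /b1 /dens -avgZr; apply: ler_avg => x _.
  rewrite /b2 /dens -avgZ; apply: ler_avg => y _.
  have := A1_sub (a' + x) (b' + y); case: (A1 _ _); last first.
    by move=> _; rewrite mulr_ge0 ?ler0n.
  by move=> /(_ isT)/andP[-> ->]; rewrite mulr1.
have bb_w : w / 2 <= b1 * b2 by apply: le_trans al_le.
have b1_w : w / 2 <= b1 by apply: le_trans bb_w _; rewrite ler_piMr.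
have b2_w : w / 2 <= b2 by apply: le_trans bb_w _; rewrite ler_piMl.
have bb_gt0 : 0 < b1 * b2 by apply: lt_le_trans bb_w; rewrite divr_gt0.
pose de := al / (b1 * b2).
have de_th : th <= de.
  by rewrite ler_pdivlMr //; move: al_ge w0; lra.
have de10 : th0 ^+ 10 <= de ^+ 10.
  by apply: lerXn2r; rewrite ?nnegrE // ?(le_trans th0_le) // (le_trans th_ge0).
have wm0 : 0 <= wmin / 2 by rewrite divr_ge0 // ltW.
have b1_2 : (wmin / 2) ^+ 2 <= b1 ^+ 2 by apply: lerXn2r; rewrite ?nnegrE //; lra.
have b2_4 : (wmin / 2) ^+ 4 <= b2 ^+ 4 by apply: lerXn2r; rewrite ?nnegrE //; lra.
have s_small : s <= de ^+ 10 * b1 ^+ 2 * b2 ^+ 4 / 128 / 128.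
  apply: le_trans s_le _; rewrite ler_pM2r ?invr_gt0 // ler_pM2r ?invr_gt0 //.
  have -> : th0 ^+ 10 * (wmin / 2) ^+ 6 = th0 ^+ 10 * (wmin / 2) ^+ 2 * (wmin / 2) ^+ 4.
    by rewrite -mulrA -exprD.
  have p i : 0 <= (wmin / 2) ^+ i by apply: exprn_ge0.
  have q : 0 <= th0 ^+ 10 by apply: exprn_ge0.
  exact: ler_pM (mulr_ge0 q (p 2)) (p 4) (ler_pM q (p 2) de10 b1_2) b2_4.
have ka_small : ka <= de ^+ 10 / 256 / 128 by move: ka_le de10; lra.
have al0 : 0 < al by apply: lt_le_trans al_w; rewrite divr_gt0.
have [|z [v [u [ve ue hvu]]]] := @corner_free_increment R G B' C' D' e eta B0 C0 D0 BC BD CD CN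
   (ltW e0) eta0 Ce (fun x => e1 (a' + x)) (fun y => e2 (b' + y))
   (fun x y => A1 (a' + x) (b' + y)) (fun x y => A1_sub _ _) _ al0 U1 U2 s s0 s_small err_le
   ka ka0 ka_small.
  move=> x y d /and3P[h1 _ _] /and3P[h2 _ _] /and3P[h3 _ _].
  by apply: (A_corner h1); rewrite -addrA.
pose v' x := v (x - a'); pose u' y := u (y - b').
pose A2 x y := [&& A x y, v' x & u' y].
have A2_sub x y : A2 x y -> v' x && u' y by case/and3P=> _ -> ->.
have hnew : ka * w / 2 <= excess v' u' A2 (th + ka) (a' + z) b' C' C'.
  apply: (@le_trans _ _ (ka * b1 * b2)).
    by have := ler_wpM2l ka0 bb_w; lra.
  apply: le_trans hvu _; apply: ler_avg => x _; apply: ler_avg => y _.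
  rewrite /A2 /v' /u' -addrA [a' + _]addrC addrK [b' + y]addrC addrK.
  rewrite [z + x + a']addrC [y + b']addrC /A1.
  have := ve (z + x); have := ue y.
  case: (v _); case: (u y) => /= hu hv; rewrite ?andbF ?mulr0 //.
  rewrite hu // hv // !andbT !mulr1 lerD2l lerN2 lerD2r //.
have kw : 0 < ka * w.
  by apply: lt_le_trans (le_trans e_ka (ler_wpM2l ka0 wmin_w)); rewrite mulr_gt0.
have th'_ge0 : 0 <= th + ka by rewrite addr_ge0.
(* Otherwise no point would contribute positively to the new excess. This bound ends the
   iteration. *)
have th'_le1 : th + ka <= 1.
  rewrite leNgt; apply/negP => th'.
  have : excess v' u' A2 (th + ka) (a' + z) b' C' C' <= 0.
    apply: avg_le => // x _; apply: avg_le => // y _.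
    have := A2_sub (a' + z + x) (b' + y); case: (A2 _ _); last first.
      by move=> _; rewrite sub0r oppr_le0 mulr_ge0 ?ler0n.
    by move=> /(_ isT) ->; rewrite mulr1 subr_le0 ltW.
  by move: hnew kw; lra.
(* The new product set lives in two translates of the same set [C']. One more refinement, with zero
   test functions, restores a wide and a narrow set; it costs [2 * e], hence [ka * w / 4] instead of
   [ka * w / 2]. *)
have zero1 (x : G) : `|(0 : R)| <= 1 by rewrite normr0.
have [B2 [C2 [D2 [cell2 CB2 CC2 _ _]]]] :=
  cell_refine kK' cell' zero1 zero1.
have [[B20 C20 D20] _ _ _] := cellP kK' cell2.
have hclose := @avg_excess_close v' u' A2 (th + ka) A2_sub th'_ge0 th'_le1 (a' + z) b' C' B2 C2
  C0 B20 C20 CB2 CC2.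
have [y yC hy] := avg_exists (fun y => \avg_(y' in C')
  excess v' u' A2 (th + ka) (a' + z + y) (b' + y') B2 C2) C0.
have [y' y'C hy'] := avg_exists (fun y' =>
  excess v' u' A2 (th + ka) (a' + z + y) (b' + y') B2 C2) C0.
exists k'.+1; first by rewrite addnS ltnS.
split=> //; exists (a' + z + y), (b' + y'), B2, C2, D2, v', u'; split=> //.
apply: le_trans hy'; apply: le_trans hy; apply: le_trans hclose.
have e_w : 8 * e <= ka * w := le_trans e_ka (ler_wpM2l ka0 wmin_w).
exact: (quarter_le e_w hnew).
Qed.

(** The threshold rises by [ka] in each stage and cannot pass 1. As [wmin] is the mass guaranteed
    after all [m] stages, one choice of [e], [eta], [s] serves throughout. *)
Lemma stage_absurd (th0 ka eta s wmin : R) n m :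
  0 < th0 -> th0 <= 1 -> 0 <= ka -> ka <= th0 ^+ 10 / 256 / 128 ->
  wmin = th0 * (ka / 4) ^+ m -> 0 < wmin -> 0 <= eta -> 0 <= s ->
  s <= th0 ^+ 10 * (wmin / 2) ^+ 6 / 128 / 128 -> 3 * e + 2 * eta <= s ^+ 2 ->
  8 * e <= ka * wmin -> 480 * e <= wmin * eta ^+ 4 -> 64 <= n%:R * (wmin * eta ^+ 4) ->
  (m * n.+1 < K)%N -> 1 < th0 + m%:R * ka -> ~ stage th0 th0 0.
Proof.
move=> th0_gt0 th0_le1 ka0 ka_le wminE wmin0 eta0 s0 s_le err_le e_ka e_eta n_big mK m_ka st0.
have ka4_0 : 0 <= ka / 4 by rewrite divr_ge0.
have ka4_1 : ka / 4 <= 1.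
  have : th0 ^+ 10 <= 1 by rewrite exprn_ile1 // ltW.
  by move: ka_le; lra.
suff iter i : (i <= m)%N -> th0 + i%:R * ka <= 1 /\
    exists2 k, (k <= i * n.+1)%N & stage (th0 + i%:R * ka) (th0 * (ka / 4) ^+ i) k.
  by have [h _] := iter m (leqnn m); move: m_ka; rewrite ltNge h.
elim: i => [_|i IH im].
  by split; rewrite mul0r addr0 //; exists 0%N; rewrite ?mul0n // expr0 mulr1.
have [th_le1 [k hk st]] := IH (ltnW im).
have wi : wmin <= th0 * (ka / 4) ^+ i.
  by rewrite wminE ler_pM2l // ler_wiXn2l // ltnW.
have wi1 : th0 * (ka / 4) ^+ i <= 1 by rewrite mulr_ile1 ?exprn_ge0 ?exprn_ile1 // ltW.
have kn : (k + n < K)%N.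
  apply: leq_ltn_trans mK; apply: leq_trans (leq_add hk (leqnSn n)) _.
  by rewrite addnC -mulSn leq_mul2r im orbT.
have th_ge : th0 <= th0 + i%:R * ka by rewrite lerDl mulr_ge0 ?ler0n.
have [k' hk' [th1 st']] := stage_step (ltW th0_gt0) th_ge th_le1 ka0 ka_le wmin0 wi wi1 eta0 s0
  s_le err_le e_ka e_eta n_big kn st.
have thE : th0 + i.+1%:R * ka = th0 + i%:R * ka + ka by rewrite -natr1 mulrDl mul1r addrA.
rewrite thE; split=> //; exists k'.
  by apply: leq_trans hk' _; rewrite mulSn addnC leq_add2l.
suff -> : th0 * (ka / 4) ^+ i.+1 = ka * (th0 * (ka / 4) ^+ i) / 4 by [].
by rewrite exprSr; field.
Qed.

End Increment.

(** * Choice of parameters *)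

Section StageConstants.
Variable t : nat.

(* With initial density [th0 = 2 ^- t], the increments are [ka = 2 ^- (10 t + 15)], all
   densities stay above [wmin = 2 ^- mass_exp], and [s = 2 ^- slack_exp],
   [eta = 2 ^- (2 slack_exp + 2)], [e = 2 ^- (gain_exp + 9)] meet the requirements of
   [stage_absurd]; each climb gains [wmin * eta ^ 4 = 2 ^- gain_exp]. *)
Definition num_stages : nat := 2 ^ (10 * t + 15).
Definition mass_exp : nat := t + (10 * t + 17) * num_stages.
Definition slack_exp : nat := 10 * t + 6 * mass_exp + 20.
Definition gain_exp : nat := mass_exp + 8 * slack_exp + 8.
Definition num_climbs : nat := 2 ^ (gain_exp + 6).
Definition num_cells : nat := (num_stages * num_climbs.+1).+1.
Definition bohr_exp : nat := (gain_exp + 10 + (10 * gain_exp).+1 * (3 * num_cells + 2) + 3)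
  * (4 * num_cells).

(** [gain_exp] is of the order of [mass_exp], hence of [num_stages] times a linear factor in [t];
    the proof reaches [2 ^ (11 * t + 31)]. *)
Lemma gain_exp_le : (0 < t)%N -> (10 * gain_exp <= 2 ^ (60 * t))%N.
Proof.
move=> t0; have tlt := ltn_expl t (isT : (1 < 2)%N).
have h1 : (10 * t + 17 <= 2 ^ (t + 5))%N by rewrite expnD; lia.
have h2 : (mass_exp <= 2 ^ (11 * t + 21))%N.
  rewrite /mass_exp /num_stages.
  have h3 : ((10 * t + 17) * 2 ^ (10 * t + 15) <= 2 ^ (11 * t + 20))%N.
    have -> : (11 * t + 20 = t + 5 + (10 * t + 15))%N by lia.
    by rewrite [in leqRHS]expnD leq_mul2r h1 orbT.
  have h4 : (t <= 2 ^ (11 * t + 20))%N.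
    by apply: leq_trans (ltnW tlt) _; rewrite leq_exp2l //; lia.
  have -> : (11 * t + 21 = (11 * t + 20).+1)%N by lia.
  rewrite expnS; lia.
have h3 : (10 * gain_exp <= 2 ^ (11 * t + 31))%N.
  rewrite /gain_exp /slack_exp.
  have -> : (11 * t + 31 = (11 * t + 21) + 10)%N by lia.
  rewrite expnD; have h4 : (2 ^ t * 2 ^ 12 <= 2 ^ (11 * t + 21))%N.
    by rewrite -expnD leq_exp2l //; lia.
  have : (t * 4096 <= 2 ^ (11 * t + 21))%N by apply: leq_trans h4; lia.
  lia.
by apply: leq_trans h3 _; rewrite leq_exp2l //; lia.
Qed.

Lemma gain_exp_ge : (168 <= gain_exp)%N.
Proof. by rewrite /gain_exp /slack_exp; lia. Qed.

(** The parameter [j = 10 * gain_exp] enters [bohr_exp] only linearly, so [bohr_exp] stays below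
    about [2 ^ (5 * gain_exp)], whereas the number [2 ^ j] of available radii is far larger. Hence
    the choice of [j] is not circular. *)
Lemma bohr_exp_lt : (bohr_exp < 2 ^ (9 * gain_exp - 10))%N.
Proof.
have b_ge := gain_exp_ge.
have t_b : (10 * t + 15 <= gain_exp)%N by rewrite /gain_exp /slack_exp; lia.
have m_le : (num_stages <= 2 ^ gain_exp)%N by rewrite leq_exp2l.
rewrite /bohr_exp /num_cells /num_climbs.
move: b_ge m_le {t_b}; move: gain_exp num_stages => b m b_ge m_le.
have b_lt : (b < 2 ^ b)%N by apply: ltn_expl.
have K_le : ((m * (2 ^ (b + 6)).+1).+1 <= 2 ^ (2 * b + 8))%N.
  have -> : (2 * b + 8 = b + b + 8)%N by lia.
  rewrite !expnD; move: m_le b_lt; set q := (2 ^ b)%N; rewrite (_ : 2 ^ 6 = 64)%N //.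
  rewrite (_ : 2 ^ 8 = 256)%N // => mq bq.
  have h1 : (m * (q * 64).+1 <= q + q * q * 64)%N by rewrite -mulnA -mulnS leq_mul2r mq orbT.
  have h2 : (q <= q * q)%N by rewrite leq_pmull //; lia.
  lia.
move: K_le; set K := (m * _).+1 => K_le.
have pos i : (0 < 2 ^ i)%N by rewrite expn_gt0.
have P0 := pos (2 * b + 8)%N; have P1 := pos (2 * b + 10)%N; have P2 := pos (3 * b + 15)%N.
have K2 : (3 * K + 2 <= 2 ^ (2 * b + 11))%N.
  have -> : (2 ^ (2 * b + 11) = 2 ^ (2 * b + 8) * 8)%N by rewrite -[11%N]/(8 + 3)%N addnA expnD.
  lia.
have j_le : ((10 * b).+1 <= 2 ^ (b + 4))%N by rewrite expnD; lia.
have s1 : ((10 * b).+1 * (3 * K + 2) <= 2 ^ (3 * b + 15))%N.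
  have -> : (3 * b + 15 = b + 4 + (2 * b + 11))%N by lia.
  by rewrite [in leqRHS]expnD leq_mul.
have s2 : (b + 10 + 3 <= 2 ^ (3 * b + 15))%N.
  apply: leq_trans (_ : 2 ^ (b + 4) <= _)%N; first by rewrite expnD; lia.
  by rewrite leq_exp2l //; lia.
have s3 : (4 * K <= 2 ^ (2 * b + 10))%N.
  have -> : (2 ^ (2 * b + 10) = 2 ^ (2 * b + 8) * 4)%N by rewrite -[10%N]/(8 + 2)%N addnA expnD.
  lia.
apply: leq_ltn_trans (_ : 2 ^ (3 * b + 16) * 2 ^ (2 * b + 10) < _)%N.
  apply: leq_mul s3.
  have -> : (2 ^ (3 * b + 16) = 2 ^ (3 * b + 15) * 2)%N by rewrite -[16%N]/(15 + 1)%N addnA expnD.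
  lia.
by rewrite -expnD ltn_exp2l //; lia.
Qed.

End StageConstants.

Section StageConstantBounds.
Variables (R : realFieldType) (t : nat).
Let h (i : nat) : R := 2^-1 ^+ i.
Let m := num_stages t.
Let M := mass_exp t.
Let a := slack_exp t.
Let b := gain_exp t.

Lemma half_exp_gt0 i : 0 < h i.
Proof. by rewrite exprn_gt0 // invr_gt0 ltr0n. Qed.
Lemma half_exp_le i i' : (i <= i')%N -> h i' <= h i.
Proof. by move=> ii'; apply: ler_wiXn2l => //; lra. Qed.
Lemma half_expD i i' : h (i + i') = h i * h i'. Proof. exact: exprD. Qed.
Lemma half_expM i i' : h (i * i') = h i ^+ i'. Proof. exact: exprM. Qed.
Lemma half_exp1 : h 1 = 2^-1. Proof. exact: expr1. Qed.
Lemma half_expK i : (2 ^ i)%:R * h i = 1.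
Proof. by rewrite natrX -exprMn mulfV ?expr1n ?pnatr_eq0. Qed.

Lemma half_ka_le : h (10 * t + 15) <= h t ^+ 10 / 256 / 128.
Proof.
rewrite half_expD [(10 * t)%N]mulnC half_expM -mulrA ler_pM2l ?(exprn_gt0 _ (half_exp_gt0 t)) //.
rewrite -[15%N]/(8 + 7)%N half_expD /h le_eqVlt; apply/orP; left; apply/eqP.
by field.
Qed.

Lemma half_wminE : h M = h t * (h (10 * t + 15) / 4) ^+ m.
Proof.
rewrite /M /mass_exp half_expD half_expM; congr (_ * _ ^+ _).
rewrite -[17%N]/(15 + 2)%N addnA half_expD; congr (_ * _); rewrite /h; by field.
Qed.

Lemma half_s_le : h a <= h t ^+ 10 * (h M / 2) ^+ 6 / 128 / 128.
Proof.
have -> : a = (t * 10 + (M + 1) * 6 + 7 + 7)%N by rewrite /a /slack_exp -/M; lia.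
move: (M) => x; rewrite !half_expD !half_expM half_expD half_exp1.
have -> : h 7 = 128^-1 by rewrite /h; by field.
by [].
Qed.

Lemma half_err_le : 3 * h (b + 9) + 2 * h (2 * a + 2) <= h a ^+ 2.
Proof.
rewrite -half_expM (mulnC a 2).
have h1 : h (b + 7) <= h (2 * a + 1).
  by apply: half_exp_le; rewrite /b /gain_exp -/a; lia.
have h2 : h (b + 9) * 4 = h (b + 7).
  by rewrite !half_expD -mulrA; congr (_ * _); rewrite /h; by field.
have h3 : h (2 * a + 2) * 4 = h (2 * a).
  by rewrite half_expD -mulrA -[RHS]mulr1; congr (_ * _); rewrite /h; by field.
have h4 : h (2 * a + 1) * 2 = h (2 * a).
  by rewrite half_expD -mulrA -[RHS]mulr1; congr (_ * _); rewrite /h; by field.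
have := half_exp_gt0 (b + 9); lra.
Qed.

Lemma half_ka_wmin : 8 * h (b + 9) <= h (10 * t + 15) * h M.
Proof.
have -> : 8 * h (b + 9) = h (b + 6).
  by rewrite -[9%N]/(6 + 3)%N addnA (half_expD (b + 6)) mulrCA /h; field.
by rewrite -half_expD; apply: half_exp_le; rewrite /b /gain_exp /slack_exp -/M; lia.
Qed.

Lemma half_gainE : h M * h (2 * a + 2) ^+ 4 = h b.
Proof. by rewrite -half_expM -half_expD; congr h; rewrite /b /gain_exp -/a -/M; lia. Qed.

Lemma half_e_gain : 480 * h (b + 9) <= h M * h (2 * a + 2) ^+ 4.
Proof.
rewrite half_gainE (half_expD b) mulrCA -[leRHS]mulr1 ler_pM2l ?half_exp_gt0 //.
have -> : h 9 = (4 * 128)^-1 by rewrite /h; by field.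
lra.
Qed.

Lemma half_climbs : 64 <= (num_climbs t)%:R * (h M * h (2 * a + 2) ^+ 4).
Proof.
rewrite half_gainE /num_climbs -/b expnD natrM mulrAC half_expK mul1r natrX.
by rewrite le_eqVlt; apply/orP; left; apply/eqP; ring.
Qed.

Lemma half_stages : 1 < h t + m%:R * h (10 * t + 15).
Proof. by rewrite half_expK ltrDr half_exp_gt0. Qed.

Lemma bernoulli n (x : R) : 0 <= x -> 1 + n%:R * x <= (1 + x) ^+ n.
Proof.
move=> x0; elim: n => [|n IH]; first by rewrite mul0r addr0.
rewrite exprS; apply: le_trans (ler_wpM2l (addr_ge0 ler01 x0) IH).
have : 0 <= n%:R * x * x by rewrite !mulr_ge0.
rewrite -natr1; lra.
Qed.

Lemma two_le_half_pow i : 2 <= (1 + h i) ^+ (2 ^ i).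
Proof.
apply: le_trans (bernoulli _ (ltW (half_exp_gt0 i))).
by rewrite half_expK.
Qed.

(** By Bernoulli [2 ^ (gain_exp + 10)] factors [1 + e / 2] already give 2; the remaining exponent
    [9 * gain_exp - 10] has to beat [bohr_exp]. *)
Lemma half_size_bound :
  (2 ^ bohr_exp t)%:R < (1 + h (b + 9) / 2) ^+ (2 ^ (10 * b)).
Proof.
have -> : h (b + 9) / 2 = h (b + 10).
  by rewrite -[10%N]/(9 + 1)%N addnA (half_expD (b + 9) 1) half_exp1.
have -> : (10 * b = b + 10 + (9 * b - 10))%N by have := gain_exp_ge t; rewrite -/b; lia.
rewrite expnD exprM; apply: lt_le_trans (_ : 2 ^+ (2 ^ (9 * b - 10)) <= _).
  by rewrite natrX ltr_eXn2l ?ltr1n // bohr_exp_lt.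
apply: lerXn2r (two_le_half_pow _); rewrite nnegrE // exprn_ge0 // addr_ge0 //.
by rewrite ltW // half_exp_gt0.
Qed.

End StageConstantBounds.

(** * Dense sets and the passage to logarithms *)

Definition has_corner (G : finZmodType) (A : {set G * G}) : Prop :=
  exists k m d : G, [/\ d != 0, (k, m) \in A, (k + d, m) \in A & (k, m + d) \in A].

(** Any nonzero [d] works: [A] and its two preimages under translation each miss less than a third
    of the points. This settles the range where [ln ln |G|] is too small for the main argument. *)
Lemma has_corner_majority (G : finZmodType) (A : {set G * G}) :
  (1 < #|G|)%N -> (2 * #|G| ^ 2 < 3 * #|A|)%N -> has_corner A.
Proof.
move=> G1 A_big.
have [d /eqP d0] : exists d : G, d <> 0.
  apply: contrapT => no; move: G1; rewrite ltnNge => /negP[].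
  rewrite -(cards1 (0 : G)) -cardsT subset_leq_card //; apply/subsetP => x _.
  by rewrite inE; apply/eqP; apply: contrapT => x0; apply: no; exists x.
pose f (p : G * G) := (p.1 + d, p.2); pose g (p : G * G) := (p.1, p.2 + d).
have f_inj : injective f by move=> [x y] [x' y'] [/addIr -> ->].
have g_inj : injective g by move=> [x y] [x' y'] [-> /addIr ->].
have cardC (h : G * G -> G * G) : injective h -> #|~: (h @^-1: A)| = #|~: A|.
  move=> h_inj; rewrite -[LHS](card_imset (mem (~: (h @^-1: A))) h_inj).
  apply: eq_card => p; apply/imsetP/idP => [[q]|].
    by rewrite !inE => qA ->.
  have [h' hK h'K] := injF_bij h_inj.
  by rewrite inE => pA; exists (h' p); rewrite ?inE h'K.
have [p] : exists p, p \in A :&: (f @^-1: A) :&: (g @^-1: A).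
  apply/set0Pn; apply: contraTneq A_big => h0; rewrite -leqNgt.
  have : (#|[set: G * G]| <= #|~: A| + #|~: (f @^-1: A)| + #|~: (g @^-1: A)|)%N.
    rewrite -setC0 -h0 !setCI; apply: leq_trans (leq_card_setU _ _) _.
    by rewrite leq_add2r leq_card_setU.
  rewrite !cardC // cardsT card_prod mulnn; have := cardsC A; rewrite card_prod mulnn.
  by move: #|A| #|~: A| (#|G| ^ 2)%N => x y z; lia.
rewrite !inE => /andP[/andP[pA pf] pg].
by exists p.1, p.2, d; split; rewrite -?surjective_pairing.
Qed.

(** The factor 2 makes the density at least twice the initial threshold [2 ^- t], so that the
    initial excess is at least [2 ^- t]. *)
Lemma has_corner_dense (G : finZmodType) (A : {set G * G}) t : (0 < t)%N ->
  (2 ^ 2 ^ 2 ^ (60 * t) <= #|G|)%N -> (2 * #|G| ^ 2 <= 2 ^ t * #|A|)%N -> has_corner A.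
Proof.
move=> t0 G_big A_big; apply: contrapT => no_corner.
pose b := gain_exp t; pose K := num_cells t.
pose h i : rat := 2^-1 ^+ i; pose e := h (b + 9)%N.
have h_gt0 i : 0 < h i := half_exp_gt0 rat i.
have sb : size_bound (b + 10) (10 * b) K = (2 ^ bohr_exp t)%N by rewrite /size_bound -expnM.
have radius_e : 2 * radius (b + 10) (10 * b) 0 <= e.
  rewrite /radius muln0 addn0 /e -[10%N]/(1 + 9)%N addnCA exprD expr1 mulrA divff //.
  by rewrite mul1r.
have bound_lt : (size_bound (b + 10) (10 * b) K)%:R < (1 + e / 2) ^+ (2 ^ (10 * b)).
  by rewrite sb; apply: half_size_bound.
have bound_G : (size_bound (b + 10) (10 * b) K)%:R <= e * #|G|%:R.
  rewrite sb mulrC -ler_pdivrMr; last exact: h_gt0.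
  have -> : e^-1 = (2 ^ (b + 9))%:R.
    by have /(canRL (mulfK (lt0r_neq0 (h_gt0 (b + 9)%N)))) := half_expK rat (b + 9); rewrite mul1r.
  rewrite -natrM ler_nat -expnD; apply: leq_trans G_big; rewrite leq_exp2l //.
  apply: leq_trans (_ : 2 ^ (10 * b) <= _)%N; last by rewrite leq_exp2l // gain_exp_le.
  have := bohr_exp_lt t; have := gain_exp_ge t; rewrite -/b => b_ge lt.
  have h1 : (2 ^ (9 * b - 10) * 2 <= 2 ^ (10 * b))%N by rewrite -expnSr leq_exp2l //; lia.
  have h2 : (b + 9 <= 2 ^ (9 * b - 10))%N.
    by apply: leq_trans (ltnW (ltn_expl _ (isT : (1 < 2)%N))) _; rewrite leq_exp2l //; lia.
  lia.
have e0 : 0 < e by apply: h_gt0.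
have ht1 : h t <= 1 by apply: (half_exp_le rat (leq0n t)).
pose A' (x y : G) := (x, y) \in A.
have A'_corner x y d : A' x y -> A' (x + d) y -> A' x (y + d) -> d = 0.
  move=> h1 h2 h3; apply/eqP; apply: contra_notT no_corner => d0.
  by exists x, y, d.
have mK : (num_stages t * (num_climbs t).+1 < K)%N by [].
apply: (@stage_absurd rat G e K (cell e (b + 10) (10 * b)) e0
  (@cellP G e (b + 10) (10 * b) K e0 radius_e bound_lt bound_G)
  (@cell_refine G e (b + 10) (10 * b) K e0 radius_e bound_lt bound_G)
  A' A'_corner (h t) (h (10 * t + 15)%N) (h (2 * slack_exp t + 2)%N) (h (slack_exp t))
  (h (mass_exp t)) (num_climbs t) (num_stages t) (h_gt0 t) ht1 (ltW (h_gt0 _))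
  (half_ka_le rat t) (half_wminE rat t) (h_gt0 _) (ltW (h_gt0 _)) (ltW (h_gt0 _))
  (half_s_le rat t) (half_err_le rat t) (half_ka_wmin rat t) (half_e_gain rat t)
  (half_climbs rat t) mK (half_stages rat t)).
(* With no frequencies every Bohr set is [G], so the first stage is [A] in all of [G] times [G]. *)
have [B [C [D [cell0 [rB [_ BE _]] [rC [_ CE _]]]]]] :=
  @cell_exists G e (b + 10) (10 * b) K e0 radius_e bound_lt bound_G [::] 0 (leq0n K) isT.
exists 0, 0, B, C, D, predT, predT; split=> //.
have bohrT r : bohr [::] r = [set: G] by apply/setP => x; rewrite !inE.
have GT : (0 < #|[set: G]|)%N by apply/card_gt0P; exists 0.
rewrite /excess BE CE !bohrT.
have -> : \avg_(x in [set: G]) \avg_(y in [set: G])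
   ((A' (0 + x) (0 + y) && (true && true))%:R - h t * (true && true)%:R)
  = #|A|%:R / #|G|%:R ^+ 2 - h t.
  transitivity (\avg_(x in [set: G]) \avg_(y in [set: G]) (((x, y) \in A)%:R - h t)).
    apply: eq_avg => x _; apply: eq_avg => y _.
    by rewrite /A' !add0r /= andbT mulr1.
  under eq_avg do rewrite avgB avg_cst //.
  rewrite avgB avg_cst // -(avg_setX [set: G] [set: G] (fun x y => ((x, y) \in A)%:R)).
  rewrite /avg cardsX !cardsT natrM -expr2; congr (_ / _ - _).
  rewrite -sum1_card natr_sum big_mkcond [RHS]big_mkcond /=; apply: eq_bigr => -[x y] _.
  by rewrite !inE /=; case: (_ \in A).
have N0 : 0 < #|G|%:R ^+ 2 :> rat by rewrite exprn_gt0 // ltr0n -cardsT.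
rewrite lerBrDr ler_pdivlMr // -(ler_pM2l (_ : 0 < (2 ^ t)%:R)) ?ltr0n ?expn_gt0 //.
rewrite mulrA mulrDr half_expK -[1 + 1]/2%:R -natrX -!natrM ler_nat.
exact: A_big.
Qed.

(** [1 + x <= exp x] at [x = - 1 / 6] gives [(6 / 5) ^ 6 = 2.985984] as an upper bound. Needed to
    have [ln ln |G|] positive already for [|G| = 3]. *)
Lemma expR1_lt3 (R : realType) : expR 1 < 3 :> R.
Proof.
have h : expR (6^-1) <= 6 / 5 :> R.
  have h1 : 5 / 6 <= expR (- 6^-1) :> R by apply: le_trans (expR_ge1Dx _); lra.
  rewrite -[6^-1]opprK expRN -[6 / 5]invrK lef_pV2 ?posrE ?expR_gt0 ?invr_gt0 //; lra.
have -> : expR 1 = expR (6^-1) ^+ 6 :> R by rewrite -expRM_natl mulfV ?pnatr_eq0.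
apply: le_lt_trans (_ : (6 / 5) ^+ 6 < 3); last by lra.
by apply: lerXn2r; rewrite ?nnegrE ?expR_ge0 //; lra.
Qed.

Lemma tower_le_of_lnln (R : realType) (N T : nat) : 1 < ln (N%:R : R) ->
  T%:R <= ln (ln (N%:R : R)) -> (2 ^ 2 ^ T <= N)%N.
Proof.
move=> lnN hT; have two_le : 2 <= expR 1 :> R by apply: le_trans (expR_ge1Dx _); lra.
have lift (n : nat) (x : R) : 0 < x -> n%:R <= ln x -> (2 ^ n)%:R <= x.
  move=> x0 hn; rewrite -[x]lnK ?posrE // natrX; apply: le_trans (_ : expR n%:R <= _).
    rewrite -[n%:R]mulr1 expRM_natl; apply: lerXn2r; rewrite ?nnegrE ?expR_ge0 //.
  by rewrite ler_expR.
have N0 : 0 < N%:R :> R.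
  by rewrite ltNge; apply: contraL lnN => h; rewrite -leNgt ln0.
rewrite -(ler_nat R).
exact: lift N0 (lift _ _ (lt_trans ltr01 lnN) hT).
Qed.

Theorem theorem1p4 (R : realType) :
  exists c : R, 0 < c /\
    forall (G : finZmodType) (A : {set G * G}),
      (3 <= #|G|)%N ->
      #|G|%:R ^+ 2 / (ln (ln (#|G|%:R : R)) `^ c) <= #|A|%:R ->
      exists k m d : G,
        [/\ d != 0, (k, m) \in A, (k + d, m) \in A & (k, m + d) \in A].
Proof.
(* [y ^ 1024 = ln ln |G|] dominates the required [2 ^ (60 t) <= (4 y) ^ 60]. *)
exists 1024^-1; split=> [|G A G3]; first by rewrite invr_gt0 ltr0n.
have G3' : 3 <= #|G|%:R :> R by rewrite (ler_nat _ 3).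
have lnN : 1 < ln (#|G|%:R : R).
  rewrite -[ltLHS](@expRK R) ltr_ln ?posrE ?expR_gt0 //; last by lra.
  exact: lt_le_trans (expR1_lt3 R) G3'.
set x := ln (ln _); set y := x `^ _.
have x0 : 0 < x by rewrite ln_gt0.
have y0 : 0 < y by rewrite powR_gt0.
have yx : y ^+ 1024 = x.
  rewrite -powR_mulrn ?(ltW y0) // /y -powRrM mulVf ?pnatr_eq0 // powRr1 ?(ltW x0) //.
rewrite ler_pdivrMr // => A_dense.
have [y_small|y_big] := ltP y (3 / 2).
  apply: has_corner_majority; first exact: leq_trans G3.
  have N0 : 0 < #|G|%:R ^+ 2 :> R by rewrite exprn_gt0 //; lra.
  have A0 : 0 < #|A|%:R :> R.
    by rewrite -(pmulr_lgt0 _ y0); apply: lt_le_trans A_dense.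
  rewrite -(ltr_nat R) [ltLHS]natrM natrX [ltRHS]natrM.
  have : #|A|%:R * y < #|A|%:R * (3 / 2) by rewrite ltr_pM2l.
  lra.
(* The density is at least [1 / y], hence at least [2 / 2 ^ t]; minimality of [t] keeps [2 ^ t]
   below [4 * y]. *)
have [t ht tmin] : exists2 t, 2 * y <= (2 ^ t)%:R & forall s, 2 * y <= (2 ^ s)%:R -> (t <= s)%N.
  have ex : exists t, 2 * y <= (2 ^ t)%:R.
    exists (Num.truncn (2 * y)).+1; apply: le_trans (ltW (truncnS_gt _)) _.
    by rewrite ler_nat ltnW // ltn_expl.
  by exists (ex_minn ex); case: ex_minnP.
have t0 : (0 < t)%N.
  by rewrite lt0n; apply: contraTneq ht => ->; rewrite expn0 -ltNge; lra.
have t_le : (2 ^ t)%:R <= 4 * y.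
  rewrite -(prednK t0) expnS natrM.
  have : (2 ^ t.-1)%:R < 2 * y.
    by rewrite ltNge; apply/negP => /tmin; rewrite leqNgt prednK ?leqnn.
  lra.
apply: (@has_corner_dense G A t t0).
  apply: (@tower_le_of_lnln R) => //; rewrite -/x -yx mulnC expnM natrX.
  (* From [y >= 3 / 2] follows [4 * y <= y ^ 9], so [(4 * y) ^ 60 <= y ^ 540], within [y ^ 1024]. *)
  have y4 : 2 <= y ^+ 4.
    apply: le_trans (_ : (3 / 2) ^+ 4 <= _); first by lra.
    by apply: lerXn2r; rewrite ?nnegrE //; lra.
  have y1 : 1 <= y by lra.
  have y9 : 4 * y <= y ^+ 9.
    rewrite -[9%N]/(4 + 4 + 1)%N !exprD expr1 ler_pM2r //.
    have -> : 4 = 2 * 2 :> R by ring.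
    by apply: ler_pM.
  apply: le_trans (_ : (y ^+ 9) ^+ 60 <= _).
    by apply: lerXn2r; rewrite ?nnegrE ?ler0n ?exprn_ge0 ?(ltW y0) // (le_trans t_le).
  by rewrite -exprM ler_weXn2l.
rewrite -(ler_nat R) [leLHS]natrM natrX [leRHS]natrM.
have : 2 * (#|A|%:R * y) <= (2 ^ t)%:R * #|A|%:R.
  by rewrite mulrCA [leRHS]mulrC ler_wpM2l.
by move: A_dense; lra.
Qed.
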